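(* Let $d=2$, $\theta\in(0,1]$, $\Delta t>0$. Suppose that the mesh $\mathcal{T}_h$ satisfies the Delaunay-type mesh condition: for every interior edge $e_{ij}$, $$\frac12\left[\widetilde\alpha_{i_K,j_K}^K+\operatorname{arccot}\!\left(\sqrt{\tfrac{\det(\mathbb{D}_K)}{\det(\mathbb{D}_{K'})}}\cot(\widetilde\alpha_{i_K,j_K}^K)\right)+\widetilde\alpha_{i_{K'},j_{K'}}^{K'}+\operatorname{arccot}\!\left(\sqrt{\tfrac{\det(\mathbb{D}_{K'})}{\det(\mathbb{D}_K)}}\cot(\widetilde\alpha_{i_{K'},j_{K'}}^{K'})\right)\right]\le\pi,$$ and that the time step size satisfies $$\frac1{6\theta}\max_{e_{ij}}\frac{|K|+|K'|}{\sqrt{\det(\mathbb{D}_K)}\cot(\widetilde\alpha_{i_K,j_K}^K)+\sqrt{\det(\mathbb{D}_{K'})}\cot(\widetilde\alpha_{i_{K'},j_{K'}}^{K'})}\ \le\ \Delta t\ \le\ \frac1{6(1-\theta)}\min_i\frac{|\omega_i|}{\sum_{K\in\omega_i}|K|\,\lambda_{\max}(\mathbb{D}_K)\,(h_{i_K}^K)^{-2}},$$ where the maximum is taken over all interior edges, $K$ and $K'$ are the two elements sharing the common edge $e_{ij}$, and the minimum is taken over all interior vertices $\boldsymbol{a}_i$. Then the scheme $$B\,\boldsymbol{u}^{n+1}=C\,\boldsymbol{u}^n+\Delta t\,\boldsymbol{f}^{n+\theta},\quad n=0,\dots,N-1,\qquad \boldsymbol{u}^0=(u_0(\boldsymbol{a}_1),\dots,u_0(\boldsymbol{a}_{N_v}))^T,$$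 satisfies a discrete maximum principle: whenever $f(\boldsymbol{x},t)\le 0$ in $\Omega_T$, its solution satisfies $$\max_{n=0,\dots,N}\ \max_{\boldsymbol{x}\in\overline{\Omega}}U^n(\boldsymbol{x})\ \le\ \max\Big\{0,\ \max_{n=1,\dots,N}\ \max_{\boldsymbol{x}\in\partial\Omega}U^n(\boldsymbol{x}),\ \max_{\boldsymbol{x}\in\overline{\Omega}}U^0(\boldsymbol{x})\Big\},$$ where $U^n(\boldsymbol{x})=\sum_{j=1}^{N_v}u_j^n\phi_j(\boldsymbol{x})$.
   Context: Problem. $\Omega\subset\mathbb{R}^2$ is a connected polygonal domain, $T>0$, $\Omega_T=\Omega\times(0,T]$. The problem being discretized is $u_t-\nabla\cdot(\mathbb{D}\nabla u)=f(\boldsymbol{x},t)$ in $\Omega_T$, $u=g(\boldsymbol{x},t)$ on $\partial\Omega\times[0,T]$, $u(\boldsymbol{x},0)=u_0(\boldsymbol{x})$, with given functions $f,g,u_0$ and a symmetric, strictly positive definite matrix-valued function $\mathbb{D}=\mathbb{D}(\boldsymbol{x})$ independent of time. Data are assumed regular enough that the integrals and point values below make sense. Mesh. $\mathcal{T}_h$ is a (conforming) triangulation of $\Omega$ with vertices $\boldsymbol{a}_1,\dots,\boldsymbol{a}_{N_v}$, ordered so that the first $N_{vi}$ are the interior vertices (the others lie on $\partial\Omega$). $\phi_j$ is the continuous piecewise linear basis function associated with $\boldsymbol{a}_j$. $|K|$ is the area of $K$ and $\mathbb{D}_K=\frac1{|K|}\int_K\mathbb{D}\,d\boldsymbol{x}$;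 $\lambda_{\max}(\mathbb{D}_K)$ is its largest eigenvalue. $\omega_i$ is the patch of elements having $\boldsymbol{a}_i$ as a vertex and $|\omega_i|$ its area. For an element $K$ containing $\boldsymbol{a}_i$, $i_K$ is the local index of $\boldsymbol{a}_i$ on $K$, and $h_{i_K}^K$ is the distance from $\boldsymbol{a}_i$ to the line containing the edge of $K$ opposite $\boldsymbol{a}_i$. Angles. For an interior edge $e_{ij}$ with endpoints $\boldsymbol{a}_i,\boldsymbol{a}_j$, $K$ and $K'$ are the two elements sharing it; $\widetilde\alpha_{i_K,j_K}^K\in(0,\pi)$ is the angle of $K$ opposite $e_{ij}$ measured in the metric $\mathbb{D}_K^{-1}$, i.e. the corresponding (Euclidean) angle of the triangle $\mathbb{D}_K^{-1/2}K$; $\widetilde\alpha_{i_{K'},j_{K'}}^{K'}$ is defined likewise for $K'$ with $\mathbb{D}_{K'}$. $\operatorname{arccot}$ is the inverse of $\cot:(0,\pi)\to\mathbb{R}$. Scheme ($\theta$-method in time, linear finite elements in space). For $i=1,\dots,N_{vi}$, $j=1,\dots,N_v$ let $$m_{ij}=\sum_{K\in\mathcal{T}_h}\int_K\phi_j\phi_i\,d\boldsymbol{x},\qquad a_{ij}=\sum_{K\in\mathcal{T}_h}|K|(\nabla\phi_i|_K)^T\mathbb{D}_K\nabla\phi_j|_K,$$ $f_i(t)=\sum_{K}\int_K f(\boldsymbol{x},t)\phi_i\,d\boldsymbol{x}$; $[M_{11}\ M_{12}]=(m_{ij})$ and $[A_{11}\ A_{12}]=(a_{ij})$, partitioned by columns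 $1..N_{vi}$ and $N_{vi}+1..N_v$. Then $$B=\begin{bmatrix}M_{11}&M_{12}\\0&I\end{bmatrix}+\theta\Delta t\begin{bmatrix}A_{11}&A_{12}\\0&0\end{bmatrix},\qquad C=\begin{bmatrix}M_{11}&M_{12}\\0&0\end{bmatrix}-(1-\theta)\Delta t\begin{bmatrix}A_{11}&A_{12}\\0&0\end{bmatrix},$$ $$\boldsymbol{f}^{n+\theta}=\Big(f_1(t_n+\theta\Delta t),\dots,f_{N_{vi}}(t_n+\theta\Delta t),\tfrac1{\Delta t}g(\boldsymbol{a}_{N_{vi}+1},t_{n+1}),\dots,\tfrac1{\Delta t}g(\boldsymbol{a}_{N_v},t_{n+1})\Big)^T,$$ where $t_n=n\Delta t$, $N\ge1$ is the number of time steps, $N\Delta t\le T$, and $\boldsymbol{u}^n=(u_1^n,\dots,u_{N_v}^n)^T$. Conventions. A quotient with positive numerator and zero denominator is $+\infty$: the lower bound cannot be met if its denominator vanishes for some interior edge, and the upper bound is no constraint when $\theta=1$. *)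

(* Defs.v *)
From HB Require Import structures.
From mathcomp Require Import all_boot all_order all_algebra.
From mathcomp Require Import all_classical all_reals all_analysis.

Set Implicit Arguments.
Unset Strict Implicit.
Unset Printing Implicit Defensive.

Import Order.TTheory GRing.Theory Num.Theory.
Import numFieldNormedType.Exports.

Local Open Scope classical_set_scope.
Local Open Scope ring_scope.

Section Plane.
Variable R : realType.

Definition dot n (u v : 'cV[R]_n) : R := (u^T *m v) ord0 ord0.

(* The library norm on matrices is the sup norm. *)
Definition enorm n (v : 'cV[R]_n) : R := Num.sqrt (dot v v).

Definition spd n (A : 'M[R]_n) : Prop :=
  A^T = A /\ forall v : 'cV[R]_n, v != 0 -> 0 < dot v (A *m v).

(* The symmetric positive definite square root (unique when A is spd). *)
Definition sqrtmx n (A : 'M[R]_n) : 'M[R]_n :=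
  xget 0 [set S | spd S /\ S *m S = A].

Definition lambda_max n (A : 'M[R]_n) : R := sup [set l | eigenvalue A l].

Definition cot (x : R) : R := cos x / sin x.

Definition arccot (y : R) : R := xget 0 [set x | 0 < x < pi /\ cot x = y].

Definition angle (u v : 'cV[R]_2) : R := acos (dot u v / (enorm u * enorm v)).

(* Angle at r of the triangle pqr in the metric A^-1, i.e. the Euclidean angle
   at the vertex A^{-1/2} r of the image of the triangle under A^{-1/2}. *)
Definition metric_angle (A : 'M[R]_2) (p q r : 'cV[R]_2) : R :=
  let S := invmx (sqrtmx A) in angle (S *m p - S *m r) (S *m q - S *m r).

(* Integration in the plane: Lebesgue measure lives on the product type
   R * R, whereas points are column vectors. *)
Definition pt (p : R * R) : 'cV[R]_2 :=
  \col_(i < 2) (if i == ord0 then p.1 else p.2).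

Definition leb2 :=
  (@lebesgue_measure R \x @lebesgue_measure R)%E.

Definition area (A : set 'cV[R]_2) : R := fine (leb2 (pt @^-1` A)).

Definition int2 (A : set 'cV[R]_2) (h : 'cV[R]_2 -> R) : R :=
  \int[leb2]_(p in pt @^-1` A) h (pt p).

Definition integrable2 (A : set 'cV[R]_2) (h : 'cV[R]_2 -> R) : Prop :=
  leb2.-integrable (pt @^-1` A) (fun p => (h (pt p))%:E).

Definition boundary (A : set 'cV[R]_2) : set 'cV[R]_2 :=
  closure A `\` interior A.

End Plane.

(* A mesh with vertices a is given by its set Th of elements, each element K
   being the set of the (global) indices of its three vertices; the closed
   triangle itself is conv_hull a K. *)
Section Mesh.
Variables (R : realType) (Nv : nat) (a : 'I_Nv -> 'cV[R]_2).
Variables (Th : {set {set 'I_Nv}}) (Omega : set 'cV[R]_2).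

Definition aff_hull (S : {set 'I_Nv}) : set 'cV[R]_2 :=
  [set x | exists w : 'I_Nv -> R,
     \sum_(i in S) w i = 1 /\ x = \sum_(i in S) w i *: a i].

Definition conv_hull (S : {set 'I_Nv}) : set 'cV[R]_2 :=
  [set x | exists w : 'I_Nv -> R,
     [/\ forall i, i \in S -> 0 <= w i,
         \sum_(i in S) w i = 1 & x = \sum_(i in S) w i *: a i]].

(* Omega is a domain and (a, Th) a conforming triangulation of it. The union of
   the closed triangles being the closure of Omega, Omega is polygonal. *)
Record triangulation : Prop := Triangulation {
  domain_open : open Omega;
  domain_nonempty : Omega !=set0;
  domain_connected : connected Omega;
  mesh_card : forall K, K \in Th -> #|K| = 3;
  mesh_nondegenerate : forall K i, K \in Th -> i \in K ->
    ~ aff_hull (K :\ i) (a i);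
  mesh_conforming : forall K K', K \in Th -> K' \in Th ->
    conv_hull K `&` conv_hull K' = conv_hull (K :&: K');
  mesh_vertices : forall i, exists2 K, K \in Th & i \in K;
  mesh_interior : forall K, K \in Th -> interior (conv_hull K) `<=` Omega;
  mesh_cover : closure Omega = \bigcup_(K in [set` Th]) conv_hull K }.

(* The edge with endpoints i and j is interior (does not lie on the boundary)
   and shared by the two elements K = {i, j, k} and K' = {i, j, k'}. *)
Definition interior_edge (i j k k' : 'I_Nv) : bool :=
  [&& k != k', [set i; j; k]%SET \in Th, [set i; j; k']%SET \in Th
    & ~~ `[< conv_hull [set i; j]%SET `<=` boundary Omega >]].

Definition patch (i : 'I_Nv) : {set {set 'I_Nv}} := [set K in Th | i \in K]%SET.

Definition patch_area (i : 'I_Nv) : R :=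
  area (\bigcup_(K in [set` patch i]) conv_hull K).

Definition height (K : {set 'I_Nv}) (i : 'I_Nv) : R :=
  inf [set enorm (a i - x) | x in aff_hull (K :\ i)].

Definition is_hat_basis (phi : 'I_Nv -> 'cV[R]_2 -> R) : Prop :=
  forall j,
    [/\ {within closure Omega, continuous (phi j)},
        forall K, K \in Th -> exists (g : 'cV[R]_2) (c : R),
          forall x, conv_hull K x -> phi j x = dot g x + c
      & forall i, phi j (a i) = (i == j)%:R].

Definition barycenter (K : {set 'I_Nv}) : 'cV[R]_2 :=
  3^-1 *: \sum_(i in K) a i.

(* The gradient on K of a function that is affine on K: being constant in the
   interior of K, it is evaluated at the barycenter. *)
Definition grad_on (K : {set 'I_Nv}) (h : 'cV[R]_2 -> R) : 'cV[R]_2 :=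
  \col_(l < 2) 'D_(delta_mx l ord0) h (barycenter K).

Variable D : 'cV[R]_2 -> 'M[R]_2.

Definition meanD (K : {set 'I_Nv}) : 'M[R]_2 :=
  \matrix_(p < 2, q < 2)
    ((area (conv_hull K))^-1 * int2 (conv_hull K) (fun x => D x p q)).

(* Angle opposite the edge with endpoints i and j in the element {i, j, k}. *)
Definition alpha (i j k : 'I_Nv) : R :=
  metric_angle (meanD [set i; j; k]%SET) (a i) (a j) (a k).

Definition delaunay_condition : Prop :=
  forall i j k k', interior_edge i j k k' ->
    let d  := \det (meanD [set i; j; k]%SET) in
    let d' := \det (meanD [set i; j; k']%SET) in
    2^-1 * (alpha i j k + arccot (Num.sqrt (d / d') * cot (alpha i j k))
          + alpha i j k' + arccot (Num.sqrt (d' / d) * cot (alpha i j k')))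
      <= pi.

(* In \bar R, 0^-1 = +oo. Ordered indices (i, j, k, k') list every interior edge
   several times, which does not affect the maximum. *)
Definition max_edge_ratio : \bar R :=
  \big[maxe/-oo%E]_(i < Nv) \big[maxe/-oo%E]_(j < Nv) \big[maxe/-oo%E]_(k < Nv)
  \big[maxe/-oo%E]_(k' < Nv | interior_edge i j k k')
    let K  := [set i; j; k]%SET in
    let K' := [set i; j; k']%SET in
    ((area (conv_hull K) + area (conv_hull K'))%:E /
     (Num.sqrt (\det (meanD K)) * cot (alpha i j k)
      + Num.sqrt (\det (meanD K')) * cot (alpha i j k'))%:E)%E.

Definition vertex_ratio (i : 'I_Nv) : R :=
  patch_area i /
  \sum_(K in patch i)
     (area (conv_hull K) * lambda_max (meanD K) * height K i ^- 2).

End Mesh.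

(* The vertices lshift Nb i are the interior ones, the vertices rshift Ni j
   those on the boundary. *)
Section Scheme.
Variables (R : realType) (Ni Nb : nat) (a : 'I_(Ni + Nb) -> 'cV[R]_2).
Variables (Th : {set {set 'I_(Ni + Nb)}}).
Variables (phi : 'I_(Ni + Nb) -> 'cV[R]_2 -> R).
Variables (D : 'cV[R]_2 -> 'M[R]_2).
Variables (f g : 'cV[R]_2 -> R -> R) (theta dt : R).

Definition min_vertex_ratio : \bar R :=
  \big[mine/+oo%E]_(i < Ni) (vertex_ratio a Th D (lshift Nb i))%:E.

Definition massmx : 'M[R]_(Ni, Ni + Nb) := \matrix_(i, j)
  \sum_(K in Th) int2 (conv_hull a K)
    (fun x => phi j x * phi (lshift Nb i) x).

Definition stiffmx : 'M[R]_(Ni, Ni + Nb) := \matrix_(i, j)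
  \sum_(K in Th) area (conv_hull a K) *
    dot (grad_on a K (phi (lshift Nb i)))
        (meanD a D K *m grad_on a K (phi j)).

Definition load (i : 'I_Ni) (t : R) : R :=
  \sum_(K in Th) int2 (conv_hull a K) (fun x => f x t * phi (lshift Nb i) x).

Definition Bmx : 'M[R]_(Ni + Nb) :=
  block_mx (lsubmx massmx) (rsubmx massmx) 0 1%:M
  + (theta * dt) *: block_mx (lsubmx stiffmx) (rsubmx stiffmx) 0 0.

Definition Cmx : 'M[R]_(Ni + Nb) :=
  block_mx (lsubmx massmx) (rsubmx massmx) 0 0
  - ((1 - theta) * dt) *: block_mx (lsubmx stiffmx) (rsubmx stiffmx) 0 0.

Definition tm (n : nat) : R := n%:R * dt.

Definition rhs (n : nat) : 'cV[R]_(Ni + Nb) :=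
  col_mx (\col_(i < Ni) load i (tm n + theta * dt))
         (\col_(j < Nb) (dt^-1 * g (a (rshift Ni j)) (tm n.+1))).

Definition fe_fun (v : 'cV[R]_(Ni + Nb)) (x : 'cV[R]_2) : R :=
  \sum_(j < Ni + Nb) v j ord0 * phi j x.

End Scheme.

(* The maximum of h over A, as an extended real; it is attained for h
   continuous and A compact and nonempty. *)
Definition max_on (R : realType) (A : set 'cV[R]_2) (h : 'cV[R]_2 -> R)
  : \bar R := ereal_sup [set (h x)%:E | x in A].

(* Main.v *)
(* Write B and C for the matrices of the scheme. In the row of an interior vertex
   the off-diagonal entries of B are nonpositive, the entries of C are
   nonnegative, and both rows have the same positive sum, since the hat functions
   add up to 1. At an interior vertex where u^{n+1} is maximal this forces
   u^{n+1} to be at most the maximum of u^n, the load being nonpositive, so the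
   maximum never increases except through the boundary values.

   For the signs, an edge {i, j} with i an interior vertex belongs to exactly two
   elements K and K', and with l_i the barycentric coordinates on K,
     int_K l_i l_j = |K| / 12,   int_K l_i^2 = |K| / 6,
     |K| grad l_i . D_K grad l_j = - sqrt (det D_K) cot alpha_ij^K / 2.
   Hence m_ij = (|K| + |K'|) / 12 and a_ij = - S / 2, S being the denominator of
   the lower bound on the time step. The mesh condition gives S >= 0: if
   S < 0 then, arccot being decreasing, the two arccot terms exceed
   pi - alpha' and pi - alpha. The upper bound on the time step controls the
   diagonal of C, because |grad l_i| is the inverse of the height. *)

Require Import Defs.
From HB Require Import structures.
From mathcomp Require Import all_boot all_order all_algebra.
From mathcomp Require Import all_classical all_reals all_analysis.
From mathcomp Require Import measurable_realfun ring lra.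

Set Implicit Arguments.
Unset Strict Implicit.
Unset Printing Implicit Defensive.

Import Order.TTheory GRing.Theory Num.Theory.
Import numFieldNormedType.Exports.

Local Open Scope classical_set_scope.
Local Open Scope ring_scope.

(** * Lebesgue measure in the plane under affine maps *)

(** Two obstacles shape the proof. First, conformity says only that two elements meet in the hull of
    their common vertices, while the signs need exactly two elements on each edge at an interior
    vertex. Openness of Omega yields an element across the edge; conformity forces the third
    vertices of any two elements on the edge to opposite sides of its line, which leaves no room for
    a third element. Second, D and f are controlled in Omega, whereas elements are closed and may
    touch the boundary; integrals over an element are therefore replaced by integrals over its
    interior, the three lines being null sets.

    The constants 1/12 and 1/6 come from the moments of (1 - x)^k on a reference triangle, whose
    section at x has length 1 - x, carried to an element by an affine change of variables. The
    square root in the metric angle disappears because sqrt (det A) times its cotangent is a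
    polynomial in A and the edges divided by twice the area. *)

Lemma lebesgue_measure_preimage_affine (R : realType) (c d : R) (A : set R) :
  c != 0 -> measurable A ->
  lebesgue_measure ((fun y => c * y + d) @^-1` A) =
  (`|c|^-1%:E * lebesgue_measure A)%E.
Proof.
move=> c0 mA.
pose h : measurableTypeR R -> measurableTypeR R := fun y => c * y + d.
have mh : measurable_fun setT h.
  by apply: measurable_funD => //; exact: measurable_funM.
have c_gt0 : 0 < `|c| by rewrite normr_gt0.
pose r := NngNum (ltW c_gt0).
pose p := measure_function_pushforward__canonical__measure_function_Measure
  (@lebesgue_measure R) mh.
(* Lebesgue measure is determined by its values on the intervals ]a, b], so the rescaled pushforward
   need only agree with it there. *)
suff -> : lebesgue_measure A = mscale r p A.
  by rewrite /mscale /= /pushforward muleA -EFinM mulVf ?gt_eqF// mul1e.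
apply: (@lebesgue_measure_unique _ (mscale r p)) => // _ [[a b]] _ <-.
change (lebesgue_measure `]a, b]%classic =
  (`|c|%:E * lebesgue_measure (h @^-1` `]a, b]%classic))%E).
rewrite /h; have [c_pos|c_neg|/eqP] := ltrgt0P c; last by rewrite (negbTE c0).
- rewrite (_ : _ @^-1` _ = `](a - d) / c, (b - d) / c]%classic); last first.
    apply/seteqP; split => y /=;
      by rewrite !in_itv/= ltr_pdivrMr// ler_pdivlMr// ltrBlDr lerBrDr mulrC.
  rewrite !lebesgue_measure_itv/= !lte_fin ltr_pM2r ?invr_gt0// ltrD2r.
  case: ifPn => _; last by rewrite mule0.
  by rewrite -!EFinB -EFinM; congr EFin; field.
(* A negative slope moves the closed end of the interval to the left, which does not affect its
   length. *)
- rewrite (_ : _ @^-1` _ = `[(b - d) / c, (a - d) / c[%classic); last first.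
    apply/seteqP; split => y /=;
    by rewrite !in_itv/= ler_ndivrMr// ltr_ndivlMr// ltrBlDr lerBrDr mulrC andbC.
  rewrite !lebesgue_measure_itv/= !lte_fin ltr_nM2r ?invr_lt0// ltrD2r.
  case: ifPn => _; last by rewrite mule0.
  by rewrite -!EFinB -EFinM; congr EFin; field.
Qed.

Section PlaneMeasure.
Variable R : realType.
Implicit Types (A : set (R * R)) (a b c d e : R).
Notation leb2 := (@leb2 R).
Notation mR2 := (measurableTypeR R * measurableTypeR R)%type.

Lemma measurable_affine a b c :
  measurable_fun setT (fun z : mR2 => a * z.1 + b * z.2 + c).
Proof.
by apply: measurable_funD => //; apply: measurable_funD; apply: measurable_funM.
Qed.

Lemma leb2_swap A : measurable (A : set mR2) ->
  leb2 A = (@lebesgue_measure R \x^ @lebesgue_measure R)%E A.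
Proof.
move=> mA; apply: product_measure_unique => // B C mB mC.
exact: product_measure2E.
Qed.

(** The first coordinate is kept, so each vertical section of the preimage is a one-dimensional
    affine preimage of a section of A, and Fubini applies. *)
Lemma leb2_shear_snd c d e A : c != 0 -> measurable (A : set mR2) ->
  leb2 ((fun z => (z.1, c * z.2 + (d * z.1 + e))) @^-1` A) =
  (`|c|^-1%:E * leb2 A)%E.
Proof.
move=> c0 mA; rewrite /Defs.leb2 /product_measure1.
under eq_integral => x _.
  rewrite /= (_ : xsection _ x =
      (fun y => c * y + (d * x + e)) @^-1` xsection A x); last first.
    by apply/seteqP; split => y; rewrite /= /xsection /= !inE.
  rewrite lebesgue_measure_preimage_affine//; last exact: measurable_xsection.
  over.
rewrite ge0_integralZl//; exact: measurable_fun_xsection.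
Qed.

Lemma leb2_shear_fst c d e A : c != 0 -> measurable (A : set mR2) ->
  leb2 ((fun z => (c * z.1 + (d * z.2 + e), z.2)) @^-1` A) =
  (`|c|^-1%:E * leb2 A)%E.
Proof.
move=> c0 mA; rewrite !leb2_swap//; last first.
  rewrite -[X in measurable X]setTI.
  suff : measurable_fun setT
    (fun z : mR2 => (c * z.1 + (d * z.2 + e), z.2) : mR2) by exact.
  apply/measurable_fun_pairP; split; last exact: measurable_snd.
  apply: eq_measurable_fun (measurable_affine c d e) => z _ /=.
  by rewrite addrA.
rewrite /product_measure2.
under eq_integral => y _.
  rewrite /= (_ : ysection _ y =
      (fun x => c * x + (d * y + e)) @^-1` ysection A y); last first.
    by apply/seteqP; split => x; rewrite /= /ysection /= !inE.
  rewrite lebesgue_measure_preimage_affine//; last exact: measurable_ysection.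
  over.
rewrite ge0_integralZl//; exact: measurable_fun_ysection.
Qed.

Definition affine2 a1 b1 c1 a2 b2 c2 (z : mR2) : mR2 :=
  (a1 * z.1 + b1 * z.2 + c1, a2 * z.1 + b2 * z.2 + c2).

Lemma measurable_affine2 a1 b1 c1 a2 b2 c2 :
  measurable_fun setT (affine2 a1 b1 c1 a2 b2 c2).
Proof. by apply/measurable_fun_pairP; split; exact: measurable_affine. Qed.

Lemma measurable_preimage_affine2 a1 b1 c1 a2 b2 c2 A :
  measurable (A : set mR2) ->
  measurable (affine2 a1 b1 c1 a2 b2 c2 @^-1` A : set mR2).
Proof.
by move=> mA; rewrite -[X in measurable X]setTI; exact: measurable_affine2.
Qed.

Lemma leb2_preimage_affine2 a1 b1 c1 a2 b2 c2 A :
  a1 * b2 - a2 * b1 != 0 -> measurable (A : set mR2) ->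
  leb2 (affine2 a1 b1 c1 a2 b2 c2 @^-1` A) =
  (`|a1 * b2 - a2 * b1|^-1%:E * leb2 A)%E.
Proof.
wlog a1_neq0 : a1 b1 c1 a2 b2 c2 / a1 != 0 => [th|] d0 mA.
  have [a10|] := eqVneq a1 0; last by move=> a10; exact: th.
  have b1_neq0 : b1 != 0.
    by apply: contra_neq d0 => b10; rewrite a10 b10; ring.
  have mB := measurable_preimage_affine2 a1 b1 c1 a2 b2 c2 mA.
  (* Composing with the area-preserving shear (x, y) -> (x, y + x) replaces the pivot a1 = 0 by a1 +
     b1 = b1, which is nonzero. *)
  have := leb2_shear_snd 1 0 (oner_neq0 R) mB.
  rewrite normr1 invr1 mul1e => <-.
  rewrite -comp_preimage.
  rewrite (_ : _ \o _ = affine2 (a1 + b1) b1 c1 (a2 + b2) b2 c2).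
    have dE : (a1 + b1) * b2 - (a2 + b2) * b1 = a1 * b2 - a2 * b1 by ring.
    by rewrite th ?dE// a10 add0r.
  by apply/funext => z; rewrite /affine2 /=; congr pair; ring.
set dt := a1 * b2 - a2 * b1.
(* Gaussian elimination with pivot a1 factors the map into two shears, of factors a1 and dt / a1. *)
have -> : affine2 a1 b1 c1 a2 b2 c2 =
    (fun z => (z.1, dt / a1 * z.2 + (a2 / a1 * z.1 + (c2 - a2 * c1 / a1)))) \o
    (fun z => (a1 * z.1 + (b1 * z.2 + c1), z.2)).
  by apply/funext => z; rewrite /affine2 /dt /=; congr pair; field.
have da0 : dt / a1 != 0 by rewrite mulf_neq0 ?invr_neq0.
rewrite comp_preimage leb2_shear_fst//; last first.
  rewrite (_ : (fun z => _) = affine2 1 0 0 (a2 / a1) (dt / a1) (c2 - a2 * c1 / a1)).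
    exact: measurable_preimage_affine2.
  by apply/funext => z; rewrite /affine2 /=; congr pair; ring.
rewrite leb2_shear_snd// muleA -EFinM; congr (_%:E * _)%E.
rewrite -invfM -normrM; congr (`| _ |^-1).
by field.
Qed.

Definition ref_triangle : set mR2 :=
  [set z | 0 <= z.1] `&` [set z | 0 <= z.2] `&` [set z | 0 <= 1 - z.1 - z.2].

Lemma measurable_halfplane a b c :
  measurable [set z : mR2 | 0 <= a * z.1 + b * z.2 + c].
Proof.
rewrite (_ : [set z | _] = (fun z : mR2 => a * z.1 + b * z.2 + c) @^-1` `[0, +oo[).
  by rewrite -[X in measurable X]setTI; exact: measurable_affine.
by apply/seteqP; split => z /=; rewrite in_itv/= andbT.
Qed.

Lemma measurable_ref_triangle : measurable ref_triangle.
Proof.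
apply: measurableI; first apply: measurableI.
- rewrite (_ : [set z | _] = [set z : mR2 | 0 <= 1 * z.1 + 0 * z.2 + 0]).
    exact: measurable_halfplane.
  by apply/funext => z /=; rewrite mul1r mul0r !addr0.
- rewrite (_ : [set z | _] = [set z : mR2 | 0 <= 0 * z.1 + 1 * z.2 + 0]).
    exact: measurable_halfplane.
  by apply/funext => z /=; rewrite mul1r mul0r add0r !addr0.
- rewrite (_ : [set z | _] = [set z : mR2 | 0 <= -1 * z.1 + -1 * z.2 + 1]).
    exact: measurable_halfplane.
  by apply/funext => z /=; congr (is_true (_ <= _)); ring.
Qed.

Lemma measurable_onemX k : measurable_fun setT (fun z : mR2 => (1 - z.1) ^+ k).
Proof. by apply: measurable_funX; exact: measurable_funB. Qed.

Lemma integral_onemX k :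
  (\int[lebesgue_measure]_(x in `[0%R, 1%R]) ((1 - x) ^+ k)%:E =
   (k.+1%:R^-1)%:E :> \bar R)%E.
Proof.
rewrite -(Rintegral_onemXn k) fineK//.
apply: integrable_fin_num => //.
apply: continuous_compact_integrable; first exact: segment_compact.
by apply: continuous_in_subspaceT => x _; exact: (@continuous_onemXn R _ _).
Qed.

(** The section at x has length 1 - x, so the integral is that of (1 - x)^(k+1) over [0, 1]. The
    cases k = 0, 1, 2 give all the integrals of hat functions below. *)
Lemma integral_ref_triangle k :
  (\int[leb2]_(z in ref_triangle) ((1 - z.1) ^+ k)%:E = (k.+2%:R^-1)%:E)%E.
Proof.
rewrite integral_mkcond /Defs.leb2 fubini_tonelli1; last 2 first.
- have mf : measurable_fun ref_triangle (fun z : mR2 => ((1 - z.1) ^+ k)%:E).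
    by apply: measurable_funTS; apply/measurable_EFinP; exact: measurable_onemX.
  by case: (measurable_restrictT (fun z : mR2 => ((1 - z.1) ^+ k)%:E)
    measurable_ref_triangle) => + _; exact.
- apply: erestrict_ge0 => z [[z1 z2] z12]; rewrite lee_fin exprn_ge0//.
  by move: z1 z2 z12 => /=; lra.
rewrite -integral_onemX [RHS]integral_mkcond; apply: eq_integral => x _.
rewrite /fubini_F /patch; case: ifPn => [|x01].
  rewrite inE /= in_itv/= => /andP[x0 x1].
  transitivity (\int[lebesgue_measure]_(y in `[0%R, (1 - x)%R]) (cst ((1 - x) ^+ k)%:E y))%E.
    rewrite [RHS]integral_mkcond; apply: eq_integral => y _; rewrite /patch.
    congr (if _ then _ else _); apply/idP/idP; rewrite !inE /ref_triangle/= in_itv/=.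
      by case=> -[_ ->]; rewrite subr_ge0.
    by case/andP => -> yx; rewrite subr_ge0.
  rewrite integral_cst//= lebesgue_measure_itv/= lte_fin subr_gt0.
  case: ltP => [_|x1']; last first.
    by rewrite mule0; congr EFin; rewrite (_ : x = 1) ?subrr ?expr0n//; lra.
  by rewrite -EFinB -EFinM subr0 exprSr.
apply: integral0_eq => y _; case: ifPn => //; rewrite inE => -[[/= x0 y0] xy].
by exfalso; move: x01; rewrite notin_setE /=; apply; rewrite /= in_itv/= x0/=; lra.
Qed.

End PlaneMeasure.

(** * Barycentric coordinates and symmetric 2 x 2 matrices *)

Section Barycentric.
Variable R : realType.
Implicit Types p q r x y z : 'cV[R]_2.

Lemma ord2P (l : 'I_2) : l = 0 \/ l = 1.
Proof. by case: l => -[|[|m]] l2 //; [left|right]; apply/val_inj. Qed.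

Lemma cV2P x y : x 0 0 = y 0 0 -> x 1 0 = y 1 0 -> x = y.
Proof.
move=> xy0 xy1; apply/matrixP => i j; rewrite (ord1 j).
by have [->|->] := ord2P i.
Qed.

Lemma mx2P (A B : 'M[R]_2) : A 0 0 = B 0 0 -> A 0 1 = B 0 1 ->
  A 1 0 = B 1 0 -> A 1 1 = B 1 1 -> A = B.
Proof.
move=> h00 h01 h10 h11; apply/matrixP => i j.
by have [->|->] := ord2P i; have [->|->] := ord2P j.
Qed.

Lemma mulmx2 m n (A : 'M[R]_(m, 2)) (B : 'M[R]_(2, n)) i j :
  (A *m B) i j = A i 0 * B 0 j + A i 1 * B 1 j.
Proof.
rewrite !mxE !big_ord_recl big_ord0 addr0.
by congr (A i _ * B _ _ + A i _ * B _ _); apply/val_inj.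
Qed.

Lemma scalemxE m n (s : R) (A : 'M[R]_(m, n)) i j : (s *: A) i j = s * A i j.
Proof. by rewrite mxE. Qed.

Lemma addmxE m n (A B : 'M[R]_(m, n)) i j : (A + B) i j = A i j + B i j.
Proof. by rewrite mxE. Qed.

Lemma dotE x y : dot x y = x 0 0 * y 0 0 + x 1 0 * y 1 0.
Proof.
rewrite /dot !mxE !big_ord_recl big_ord0 addr0 !mxE.
by congr (x _ _ * y _ _ + x _ _ * y _ _); apply/val_inj.
Qed.

Lemma dotZr s x y : dot x (s *: y) = s * dot x y.
Proof. by rewrite !dotE !mxE; ring. Qed.

Lemma dotZl s x y : dot (s *: x) y = s * dot x y.
Proof. by rewrite !dotE !mxE; ring. Qed.

Lemma dotNr x y : dot x (- y) = - dot x y.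
Proof. by rewrite !dotE !mxE; ring. Qed.

Lemma dotDr x y z : dot x (y + z) = dot x y + dot x z.
Proof. by rewrite !dotE !mxE; ring. Qed.

(** Twice the signed area of the triangle with vertices p, q, r. *)
Definition cross p q r : R :=
  (q 0 0 - p 0 0) * (r 1 0 - p 1 0) - (q 1 0 - p 1 0) * (r 0 0 - p 0 0).

(** By Cramer's rule, the barycentric coordinate of x at p; rotating the first three arguments gives
    the coordinates at q and r. *)
Definition bary p q r x : R := cross x q r / cross p q r.

(** A quarter turn of the edge opposite p, divided by twice the signed area. *)
Definition bary_grad p q r : 'cV[R]_2 :=
  (cross p q r)^-1 *: \col_(l < 2) (if l == 0 then q 1 0 - r 1 0 else r 0 0 - q 0 0).

Lemma cross_rot p q r : cross q r p = cross p q r.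
Proof. by rewrite /cross; ring. Qed.

Lemma bary_sum p q r x : cross p q r != 0 ->
  bary p q r x + bary q r p x + bary r p q x = 1.
Proof.
move=> c0; rewrite /bary (cross_rot q r p) !(cross_rot p q r).
by rewrite -!mulrDl -[RHS](divff c0); congr (_ / _); rewrite /cross; ring.
Qed.

Lemma bary_comb p q r x : cross p q r != 0 ->
  x = bary p q r x *: p + bary q r p x *: q + bary r p q x *: r.
Proof.
move=> c0; rewrite /bary (cross_rot q r p) !(cross_rot p q r).
by apply: cV2P; rewrite !mxE /cross; field; exact: c0.
Qed.

Lemma baryE p q r (u v w : R) : cross p q r != 0 -> u + v + w = 1 ->
  bary p q r (u *: p + v *: q + w *: r) = u.
Proof.
move=> c0 uvw; apply: (mulIf c0); rewrite /bary mulfVK//.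
by rewrite /cross !mxE (_ : u = 1 - v - w); [ring|rewrite -uvw; ring].
Qed.

Lemma bary_affine p q r x y : cross p q r != 0 ->
  bary p q r x = bary p q r y + dot (bary_grad p q r) (x - y).
Proof.
move=> c0; apply: (mulIf c0); rewrite mulrDl /bary !mulfVK// dotE !mxE /=.
rewrite -!mulrA -mulrDr mulrC mulrA divff// mul1r /cross; ring.
Qed.

Lemma bary_grad0 p q r : cross p q r != 0 ->
  bary_grad p q r + bary_grad q r p + bary_grad r p q = 0.
Proof.
move=> c0; apply: cV2P; rewrite !mxE/= (cross_rot q r p) !(cross_rot p q r);
 rewrite -!mulrDr; apply/eqP; rewrite mulf_eq0; apply/orP; right; apply/eqP; ring.
Qed.

End Barycentric.

Section SymmetricMatrix.
Variable R : realType.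
Implicit Types (A S : 'M[R]_2) (u v w p q r x : 'cV[R]_2).

Lemma det2E A : \det A = A 0 0 * A 1 1 - A 0 1 * A 1 0.
Proof.
rewrite (expand_det_row _ 0) !big_ord_recl big_ord0 addr0 /cofactor.
rewrite !det_mx11 !mxE /= expr0 mul1r expr1 mulN1r mulrN.
by congr (A 0 _ * A _ _ - A 0 _ * A _ _); apply/val_inj.
Qed.

(* [\det A * u^T A^-1 w] for symmetric A, written without the inverse. *)
Definition codot A u w : R :=
  A 1 1 * (u 0 0 * w 0 0) - A 0 1 * (u 0 0 * w 1 0 + u 1 0 * w 0 0)
  + A 0 0 * (u 1 0 * w 1 0).

Lemma sym_offdiag A : A^T = A -> A 1 0 = A 0 1.
Proof. by move=> AT; rewrite -[in LHS]AT mxE. Qed.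

Lemma spd_det_gt0 A : spd A -> [/\ 0 < A 0 0, 0 < A 1 1 & 0 < \det A].
Proof.
move=> [/sym_offdiag As Apos].
have q v : dot v (A *m v) = A 0 0 * v 0 0 ^+ 2 + 2 * A 0 1 * v 0 0 * v 1 0 + A 1 1 * v 1 0 ^+ 2.
  by rewrite dotE !mulmx2 As; ring.
have A00 : 0 < A 0 0.
  have := Apos (delta_mx 0 0); rewrite q !mxE /=.
  rewrite expr1n expr0n /= !mulr0 !mulr1 !addr0; apply.
  by apply/eqP => /matrixP/(_ 0 0); rewrite !mxE/= => /eqP; rewrite oner_eq0.
have A11 : 0 < A 1 1.
  have := Apos (delta_mx 1 0); rewrite q !mxE /=.
  rewrite expr1n expr0n /= !mulr0 !mulr1 ?mul0r !add0r; apply.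
  by apply/eqP => /matrixP/(_ 1 0); rewrite !mxE/= => /eqP; rewrite oner_eq0.
split => //.
(* At this vector the quadratic form takes the value A 0 0 * det A. *)
pose v : 'cV[R]_2 := \col_(l < 2) (if l == 0 then - A 0 1 else A 0 0).
have := Apos v; rewrite q !mxE /= det2E As => /(_ _)/wrap[].
  apply/eqP => /matrixP/(_ 1 0); rewrite !mxE/= => /eqP.
  by rewrite gt_eqF.
rewrite (_ : _ + _ = A 0 0 * (A 0 0 * A 1 1 - A 0 1 * A 0 1)); last by ring.
by rewrite pmulr_rgt0.
Qed.

(** The gradients are quarter turns of q - r and r - p, and conjugating a symmetric A by a quarter
    turn gives its adjugate, the matrix of [codot A]. *)
Lemma codot_cross A p q r : A^T = A -> cross p q r != 0 ->
  dot (bary_grad p q r) (A *m bary_grad q r p) =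
  - codot A (p - r) (q - r) / cross p q r ^+ 2.
Proof.
move=> /sym_offdiag As c0.
rewrite dotE !mulmx2 !mxE/= (cross_rot p q r) /codot As !mxE.
by field.
Qed.

End SymmetricMatrix.

(** * Cotangents of angles in the metric A^-1 *)

Section Angle.
Variable R : realType.
Implicit Types (A S : 'M[R]_2) (u v w p q r x : 'cV[R]_2) (s t : R).

(** This follows from cot s - cot t = sin (t - s) / (sin s sin t). *)
Lemma cot_lt s t : 0 < s < pi -> 0 < t < pi -> cot s < cot t -> t < s.
Proof.
move=> s0 t0 st; rewrite ltNge; apply/negP => le_st.
have [/andP[s1 s2] /andP[t1 t2]] := (s0, t0).
have ss : 0 < sin s by rewrite sin_gt0_pi.
have st0 : 0 < sin t by rewrite sin_gt0_pi.
have : 0 <= sin (t - s).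
  by apply: sin_ge0_pi; rewrite subr_ge0 le_st/= lerBlDr; lra.
rewrite sinB; move: st; rewrite /cot ltr_pdivrMr// mulrAC ltr_pdivlMr// => h1 h2.
by move: h2; rewrite subr_ge0 => /(lt_le_trans _)-/(_ _ h1)/= ; rewrite mulrC ltxx.
Qed.

(** The right triangle with legs s and t. With t = 1 it shows that [arccot] is well defined; with s
    = P . Q and t = |P x Q| it gives the cotangent of the angle between P and Q. *)
Lemma cot_acos_div s t : 0 < t -> -1 < s / Num.sqrt (s ^+ 2 + t ^+ 2) < 1 /\
  cot (acos (s / Num.sqrt (s ^+ 2 + t ^+ 2))) = s / t.
Proof.
move=> t0; set d := s ^+ 2 + t ^+ 2.
have d0 : 0 < d by rewrite ltr_wpDl ?sqr_ge0// exprn_gt0.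
have sd0 : 0 < Num.sqrt d by rewrite sqrtr_gt0.
have dE : Num.sqrt d ^+ 2 = d by rewrite sqr_sqrtr// ltW.
have c2 : (s / Num.sqrt d) ^+ 2 = 1 - (t / Num.sqrt d) ^+ 2.
  by rewrite !expr_div_n dE /d; field; rewrite gt_eqF.
have lt1 : (s / Num.sqrt d) ^+ 2 < 1.
  by rewrite c2 ltrBlDr ltrDl exprn_gt0// divr_gt0.
have b : -1 < s / Num.sqrt d < 1.
  by rewrite -ltr_norml -(@ltr_pXn2r _ 2)// ?nnegrE// real_normK ?num_real// expr1n.
split => //; have /andP[b1 b2] := b.
have bi : -1 <= s / Num.sqrt d <= 1 by rewrite !ltW.
rewrite /cot acosK; last by rewrite in_itv.
rewrite sin_acos// c2 opprB addrC subrK sqrtr_sqr ger0_norm; last by rewrite divr_ge0 ?ltW.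
by field; rewrite !gt_eqF.
Qed.

Lemma arccotP t : 0 < arccot t < pi /\ cot (arccot t) = t.
Proof.
have [b e] := cot_acos_div t (@ltr01 R).
apply: (@xgetPex _ _ [set x | 0 < x < pi /\ cot x = t]).
exists (acos (t / Num.sqrt (t ^+ 2 + 1 ^+ 2))) => /=; split; last by rewrite e divr1.
have /andP[b1 b2] := b.
by rewrite acos_gt0 ?acos_ltpi ?b1 ?b2 ?ltW.
Qed.

Lemma dot_gt0 u : u != 0 -> 0 < dot u u.
Proof.
move=> u0; rewrite lt_neqAle dotE -!expr2 addr_ge0 ?sqr_ge0// andbT eq_sym.
apply: contra u0; rewrite paddr_eq0 ?sqr_ge0// !sqrf_eq0 => /andP[/eqP a /eqP b].
by apply/eqP/cV2P; rewrite mxE.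
Qed.

(* By Cayley-Hamilton, with s^2 = det A and t^2 = tr A + 2 s, the matrix
   (A + s I) / t squares to A. *)
Lemma sqrtmxP A : spd A -> spd (sqrtmx A) /\ sqrtmx A *m sqrtmx A = A.
Proof.
move=> spdA; have [A00 A11 dA] := spd_det_gt0 spdA.
have [AT Apos] := spdA; have As := sym_offdiag AT.
apply: (@xgetPex _ _ [set S | spd S /\ S *m S = A]).
pose s := Num.sqrt (\det A); pose t := Num.sqrt (A 0 0 + A 1 1 + 2 * s).
have s0 : 0 < s by rewrite sqrtr_gt0.
have t0 : 0 < t by rewrite sqrtr_gt0; lra.
have sE : s ^+ 2 = A 0 0 * A 1 1 - A 0 1 * A 0 1.
  by rewrite sqr_sqrtr ?ltW// det2E As.
have tE : t ^+ 2 = A 0 0 + A 1 1 + 2 * s by rewrite sqr_sqrtr; lra.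
exists (t^-1 *: (A + s%:M)); split; last first.
  rewrite -scalemxAl -scalemxAr scalerA -invfM -expr2 tE.
  have -> : (A + s%:M) *m (A + s%:M) = (A 0 0 + A 1 1 + 2 * s) *: A.
    apply: mx2P; rewrite mulmx2 !mxE/= ?mulr1n ?mulr0n ?As.
    - by move: sE; lra.
    - ring.
    - ring.
    - by move: sE; lra.
  by rewrite scalerA mulVf ?scale1r// gt_eqF//; lra.
split; first by rewrite linearZ/= linearD/= AT tr_scalar_mx.
move=> v v0; rewrite -scalemxAl mulmxDl mul_scalar_mx.
have := Apos _ v0; have := dot_gt0 v0; rewrite !dotE !mulmx2 => h1 h2.
rewrite (_ : _ + _ = t^-1 * (v 0 0 * (A 0 0 * v 0 0 + A 0 1 * v 1 0) +
  v 1 0 * (A 1 0 * v 0 0 + A 1 1 * v 1 0) +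
  s * (v 0 0 * v 0 0 + v 1 0 * v 1 0))).
  by rewrite mulr_gt0 ?invr_gt0// addr_gt0// mulr_gt0.
by rewrite !(scalemxE, addmxE, mulmx2); ring.
Qed.

End Angle.

Section MetricAngle.
Variable R : realType.
Implicit Types (A S : 'M[R]_2) (u v w p q r x : 'cV[R]_2) (s t : R).

(** Pulling the edges back by S = A^{1/2} to P and Q divides [cross] by det S and turns [codot A]
    into det A * (P . Q), while the cotangent is P . Q / |P x Q|. *)
Lemma sqrt_det_cot A p q r : spd A -> cross p q r != 0 ->
  Num.sqrt (\det A) * cot (metric_angle A p q r) =
    codot A (p - r) (q - r) / `|cross p q r| /\
  0 < metric_angle A p q r < pi.
Proof.
move=> spdA c0; have [spdS SS] := sqrtmxP spdA.
have [_ _ dA] := spd_det_gt0 spdA; have [_ _ dS] := spd_det_gt0 spdS.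
have SsT := sym_offdiag spdS.1.
rewrite /metric_angle; set S := sqrtmx A in SS dS SsT *.
have uS : S \in unitmx by rewrite unitmxE unitfE gt_eqF.
rewrite -!mulmxBr.
have [P PE] : exists P, P = invmx S *m (p - r) by eexists.
have [Q QE] : exists Q, Q = invmx S *m (q - r) by eexists.
rewrite -PE -QE.
have pE : p - r = S *m P by rewrite PE mulmxA mulmxV// mul1mx.
have qE : q - r = S *m Q by rewrite QE mulmxA mulmxV// mul1mx.
pose k := P 0 0 * Q 1 0 - P 1 0 * Q 0 0.
have ck : cross p q r = \det S * k.
  have [p0 p1 q0 q1] : [/\ p 0 0 = (S *m P) 0 0 + r 0 0, p 1 0 = (S *m P) 1 0 + r 1 0,
      q 0 0 = (S *m Q) 0 0 + r 0 0 & q 1 0 = (S *m Q) 1 0 + r 1 0].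
    by rewrite -pE -qE !mxE !subrK.
  rewrite /cross p0 p1 q0 q1 !mulmx2 det2E /k. ring.
have k0 : k != 0 by apply: contra_neq c0; rewrite ck => ->; rewrite mulr0.
have detA : \det A = \det S ^+ 2 by rewrite -SS det_mulmx.
have codE : codot A (p - r) (q - r) = \det S ^+ 2 * dot P Q.
  rewrite pE qE /codot !mulmx2 -SS !mulmx2 det2E dotE SsT. ring.
(* Lagrange's identity, k being the cross product of P and Q; it puts the angle in the form required
   by [cot_acos_div]. *)
have nrm : enorm P * enorm Q = Num.sqrt (dot P Q ^+ 2 + `|k| ^+ 2).
  rewrite /enorm -sqrtrM; last by rewrite dotE -!expr2 addr_ge0 ?sqr_ge0.
  by congr Num.sqrt; rewrite real_normK ?num_real// !dotE /k; ring.
have nk : 0 < `|k| by rewrite normr_gt0.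
have [/andP[b1 b2] cE] := cot_acos_div (dot P Q) nk.
rewrite /angle nrm; split; last by rewrite acos_gt0 ?acos_ltpi ?b1 ?b2 ?ltW.
rewrite cE codE ck normrM detA sqrtr_sqr (gtr0_norm dS).
by field; rewrite (gt_eqF nk) (gt_eqF dS).
Qed.

(** If l is the larger root of the characteristic polynomial, then l I - A is positive semidefinite.
    Since [lambda_max] is a supremum, l <= [lambda_max A] also requires the set of eigenvalues to be
    bounded above. *)
Lemma lambda_max_ge A v : A^T = A -> dot v (A *m v) <= lambda_max A * dot v v.
Proof.
move=> /sym_offdiag As.
pose dl := (A 0 0 - A 1 1) ^+ 2 + 4 * A 0 1 ^+ 2.
have dl0 : 0 <= dl by rewrite addr_ge0 ?sqr_ge0// mulr_ge0 ?sqr_ge0.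
pose s := Num.sqrt dl; have s0 : 0 <= s by exact: sqrtr_ge0.
have sE : s ^+ 2 = (A 0 0 - A 1 1) ^+ 2 + 4 * A 0 1 ^+ 2 by rewrite sqr_sqrtr.
pose l := (A 0 0 + A 1 1 + s) / 2.
have eigP m : eigenvalue A m = ((m - A 0 0) * (m - A 1 1) == A 0 1 ^+ 2).
  rewrite /eigenvalue /eigenspace kermx_eq0 row_free_unit unitmxE unitfE negbK.
  rewrite det2E !mxE /= !mulr1n !mulr0n As -[RHS]subr_eq0; congr (_ == 0); ring.
have lE : (l - A 0 0) * (l - A 1 1) = A 0 1 ^+ 2 by rewrite /l; lra.
have sge : `|A 0 0 - A 1 1| <= s.
  by rewrite -sqrtr_sqr ler_wsqrtr// lerDl mulr_ge0 ?sqr_ge0.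
have /andP[l0 l1] : (0 <= l - A 0 0) && (0 <= l - A 1 1).
  by rewrite /l; move: sge; rewrite ler_norml => /andP[? ?]; apply/andP; split; lra.
have le_l : l <= lambda_max A.
  apply: ub_le_sup; last by rewrite /= eigP lE.
  (* For m beyond this bound both m - A 0 0 and m - A 1 1 exceed |A 0 1|, so their product cannot be
     (A 0 1)^2. *)
  exists (`|A 0 0| + `|A 1 1| + `|A 0 1|) => m /=; rewrite eigP => /eqP mE.
  rewrite leNgt; apply/negP => mlt.
  have := ler_norm (A 0 0); have := ler_norm (A 1 1) => le1 le0.
  have n0 := normr_ge0 (A 0 0); have n1 := normr_ge0 (A 1 1).
  have : `|A 0 1| * `|A 0 1| < (m - A 0 0) * (m - A 1 1).
    by apply: ltr_pM => //; lra.
  by rewrite mE -expr2 real_normK ?num_real// ltxx.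
apply: (@le_trans _ _ (l * dot v v)); last first.
  by rewrite ler_wpM2r// dotE -!expr2 addr_ge0 ?sqr_ge0.
rewrite !dotE !mulmx2 As.
set a := l - A 0 0 in lE l0; set b := l - A 1 1 in lE l1.
rewrite -subr_ge0 (_ : _ - _ = a * v 0 0 ^+ 2 + b * v 1 0 ^+ 2 - 2 * A 0 1 * v 0 0 * v 1 0);
  last by rewrite /a /b; ring.
have [a0|a_gt0] := eqVneq a 0.
  have A0 : A 0 1 = 0 by apply/eqP; rewrite -sqrf_eq0 -lE a0 mul0r.
  by rewrite a0 A0 mul0r mulr0 !mul0r add0r subr0 mulr_ge0 ?sqr_ge0.
have a1 : 0 < a by rewrite lt_neqAle eq_sym a_gt0.
(* Multiplied by a, the form is a perfect square, because a b = (A 0 1)^2. *)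
rewrite -(pmulr_rge0 _ a1).
rewrite [leRHS](_ : _ = (a * v 0 0 - A 0 1 * v 1 0) ^+ 2).
  exact: sqr_ge0.
have -> : (a * v 0 0 - A 0 1 * v 1 0) ^+ 2 =
  a ^+ 2 * v 0 0 ^+ 2 + A 0 1 ^+ 2 * v 1 0 ^+ 2
  - 2 * a * A 0 1 * v 0 0 * v 1 0 by ring.
by rewrite -lE; ring.
Qed.
End MetricAngle.

Section Delaunay.
Variable R : realType.
Implicit Types s t d : R.

Lemma delaunay_edge_ge0 s s' d d' : 0 < d -> 0 < d' ->
  0 < s < pi -> 0 < s' < pi ->
  2^-1 * (s + arccot (Num.sqrt (d / d') * cot s)
        + s' + arccot (Num.sqrt (d' / d) * cot s')) <= pi ->
  0 <= Num.sqrt d * cot s + Num.sqrt d' * cot s'.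
Proof.
move=> d0 d0' s0 s0' hs; rewrite leNgt; apply/negP => lt0.
have arccot_gt (x x' e e' : R) : 0 < e -> 0 < e' -> 0 < x' < pi ->
    Num.sqrt e * cot x + Num.sqrt e' * cot x' < 0 ->
    pi - x' < arccot (Num.sqrt (e / e') * cot x).
  move=> e0 e0' x0' h.
  have [b0 cb] := arccotP (Num.sqrt (e / e') * cot x).
  apply: cot_lt => //; first by case/andP: x0' => ? ?; apply/andP; split; lra.
  (* Dividing h by sqrt e' gives sqrt (e / e') cot x < - cot x' = cot (pi - x'). *)
  have -> : cot (pi - x') = - cot x'.
    rewrite /cot cosB sinB cospi sinpi !mul0r addr0 sub0r !mulN1r opprK.
    by rewrite mulNr.
  rewrite cb sqrtrM ?ltW// sqrtrV ?ltW// mulrAC ltr_pdivrMr ?sqrtr_gt0//.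
  by rewrite mulNr ltrNr -subr_lt0 opprK mulrC [_ * cot x']mulrC; lra.
have h1 := arccot_gt _ _ _ _ d0 d0' s0' lt0.
have h2 : pi - s < arccot (Num.sqrt (d' / d) * cot s').
  by apply: arccot_gt; rewrite // addrC.
by move: hs; lra.
Qed.

End Delaunay.

(** * Triangles of the mesh *)

Section Triangle.
Variables (R : realType) (Nv : nat) (a : 'I_Nv -> 'cV[R]_2).
Implicit Types (x : 'cV[R]_2) (i j k l : 'I_Nv) (K : {set 'I_Nv}).

Lemma sum_set2 (T : finType) (V : nmodType) (j k : T) (F : T -> V) :
  j != k -> \sum_(l in [set j; k]%SET) F l = F j + F k.
Proof. by move=> jk; rewrite big_setU1 ?inE//= big_set1. Qed.

Lemma sum_set3 (V : nmodType) i j k (F : 'I_Nv -> V) :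
  i != j -> i != k -> j != k ->
  \sum_(l in [set i; j; k]%SET) F l = F i + F j + F k.
Proof.
by move=> ij ik jk; rewrite -finset.setUA !big_setU1 ?inE ?negb_or ?ij ?ik//= big_set1 addrA.
Qed.

Lemma set3_rot i j k : [set j; k; i]%SET = [set i; j; k]%SET.
Proof. by apply/setP => l; rewrite !inE; case: (l == i); case: (l == j); case: (l == k). Qed.

Lemma set3D1 i j k : i != j -> i != k -> ([set i; j; k] :\ i = [set j; k])%SET.
Proof.
move=> ij ik; apply/setP => l; rewrite !inE; have [->|] := eqVneq l i => //=.
by rewrite (negbTE ij) (negbTE ik).
Qed.

(** Three linear inequalities in place of an existential over weights: closedness, interior points
    and measurability of an element all go through this form. *)
Lemma conv_hull3 i j k x : i != j -> i != k -> j != k ->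
  cross (a i) (a j) (a k) != 0 ->
  conv_hull a [set i; j; k]%SET x <->
  [/\ 0 <= bary (a i) (a j) (a k) x, 0 <= bary (a j) (a k) (a i) x
    & 0 <= bary (a k) (a i) (a j) x].
Proof.
move=> ij ik jk c0; split.
  have c1 : cross (a j) (a k) (a i) != 0 by rewrite cross_rot.
  have c2 : cross (a k) (a i) (a j) != 0 by rewrite cross_rot.
  case=> w [w0]; rewrite !sum_set3// => w1 ->.
  have [wi wj wk] : [/\ 0 <= w i, 0 <= w j & 0 <= w k].
    by split; apply: w0; rewrite !inE eqxx ?orbT.
  split; rewrite ?baryE//.
    rewrite [X in bary _ _ _ X](_ : _ = w j *: a j + w k *: a k + w i *: a i).
      by rewrite baryE// -w1; ring.
    by rewrite -addrA addrC.
  rewrite [X in bary _ _ _ X](_ : _ = w k *: a k + w i *: a i + w j *: a j).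
    by rewrite baryE// -w1; ring.
  by rewrite addrC addrA.
case=> b1 b2 b3.
exists (fun l => if l == i then bary (a i) (a j) (a k) x else
  if l == j then bary (a j) (a k) (a i) x else bary (a k) (a i) (a j) x).
split; first by move=> l _; case: ifP => // _; case: ifP.
  rewrite sum_set3// eqxx (eq_sym j) (negbTE ij) eqxx !(eq_sym k).
  by rewrite (negbTE ik) (negbTE jk) bary_sum.
rewrite sum_set3// eqxx (eq_sym j) (negbTE ij) eqxx !(eq_sym k) (negbTE ik) (negbTE jk).
exact: bary_comb.
Qed.

Lemma aff_hull2 i j k x : j != k -> cross (a i) (a j) (a k) != 0 ->
  aff_hull a [set j; k]%SET x <-> bary (a i) (a j) (a k) x = 0.
Proof.
move=> jk c0; split.
  case=> w; rewrite !sum_set2// => -[w1 ->].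
  have -> : w j *: a j + w k *: a k = 0 *: a i + w j *: a j + w k *: a k.
    by rewrite scale0r add0r.
  by rewrite baryE// add0r.
move=> b0; exists (fun l => if l == j then bary (a j) (a k) (a i) x else bary (a k) (a i) (a j) x).
rewrite !sum_set2// eqxx eq_sym (negbTE jk); split.
  by have := bary_sum x c0; rewrite b0 add0r.
by have := bary_comb x c0; rewrite b0 scale0r add0r.
Qed.

(** If [cross] vanished, either a j = a k would lie in the hull of the other two vertices, or a i
    would equal its projection onto the line through a j and a k. *)
Lemma cross_neq0 i j k : i != j -> i != k -> j != k ->
  (forall l, l \in [set i; j; k]%SET -> ~ aff_hull a ([set i; j; k] :\ l)%SET (a l)) ->
  cross (a i) (a j) (a k) != 0.
Proof.
move=> ij ik jk nd; apply/negP => /eqP c0.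
have aff2 (l m n : 'I_Nv) (u v : R) : m != n -> u + v = 1 ->
    aff_hull a [set m; n]%SET (u *: a m + v *: a n).
  move=> mn uv; exists (fun l => if l == m then u else v).
  by rewrite !sum_set2// eqxx eq_sym (negbTE mn).
have [jk0|jk0] := eqVneq (a j) (a k).
  apply: (nd j); first by rewrite !inE eqxx orbT.
  rewrite -set3_rot set3D1// 1?eq_sym//.
  rewrite (_ : a j = 1 *: a k + 0 *: a i); last by rewrite scale1r scale0r addr0.
  by apply: aff2; rewrite ?addr0// eq_sym.
apply: (nd i); first by rewrite !inE eqxx.
rewrite set3D1//.
pose e := a k - a j.
have e0 : 0 < dot e e by apply: dot_gt0; rewrite subr_eq0 eq_sym.
(* The parameter of the orthogonal projection of a i; the residual has no component along e by this
   choice and none across e because [cross] is zero. *)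
pose t := dot (a i - a j) e / dot e e.
rewrite (_ : a i = (1 - t) *: a j + t *: a k).
  by apply: aff2 => //; rewrite subrK.
have tE : t * dot e e = dot (a i - a j) e by rewrite mulfVK ?gt_eqF.
move: c0; rewrite -cross_rot /cross => c0.
move: tE e0; rewrite !dotE /e !mxE => tE e0.
set E0 := a k 0 0 - a j 0 0 in c0 tE e0; set E1 := a k 1 0 - a j 1 0 in c0 tE e0.
set d0 := a i 0 0 - a j 0 0 in c0 tE; set d1 := a i 1 0 - a j 1 0 in c0 tE.
have h0 : d0 - t * E0 = 0.
  apply: (mulIf (lt0r_neq0 e0)); rewrite mul0r.
  have -> : (d0 - t * E0) * (E0 * E0 + E1 * E1) = - E1 * (E0 * d1 - E1 * d0)
      - E0 * (t * (E0 * E0 + E1 * E1) - (d0 * E0 + d1 * E1)) by ring.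
  by rewrite c0 tE subrr !mulr0 subrr.
have h1 : d1 - t * E1 = 0.
  apply: (mulIf (lt0r_neq0 e0)); rewrite mul0r.
  have -> : (d1 - t * E1) * (E0 * E0 + E1 * E1) = E0 * (E0 * d1 - E1 * d0)
      - E1 * (t * (E0 * E0 + E1 * E1) - (d0 * E0 + d1 * E1)) by ring.
  by rewrite c0 tE subrr !mulr0 subrr.
apply: cV2P; rewrite !mxE; apply/eqP; rewrite -subr_eq0; apply/eqP.
  by rewrite -[RHS]h0 /d0 /E0; ring.
by rewrite -[RHS]h1 /d1 /E1; ring.
Qed.

End Triangle.

(** * Interior, gradients and heights of a triangle *)

Section TriangleTopology.
Variables (R : realType) (Nv : nat) (a : 'I_Nv -> 'cV[R]_2).
Implicit Types (x y z v p q r g : 'cV[R]_2) (i j k l : 'I_Nv) (K : {set 'I_Nv}).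

Lemma continuous_dot g : continuous (dot g).
Proof.
move=> x; rewrite (_ : dot g = fun y : 'cV[R]_2 => g 0 0 * y 0 0 + g 1 0 * y 1 0); last first.
  by apply/funext => y; rewrite dotE.
have c (i : 'I_2) : (fun y : 'cV[R]_2 => g i 0 * y i 0) y @[y --> x] --> g i 0 * x i 0.
  apply: (@cvgM R _ (nbhs x)).
    exact: cvg_cst.
  exact: coord_continuous.
exact: (@cvgD _ _ _ (nbhs x) _ _ _ _ _ (c 0) (c 1)).
Qed.

Lemma baryE0 p q r x : cross p q r != 0 ->
  bary p q r x = dot (bary_grad p q r) x + bary p q r 0.
Proof. by move=> c0; rewrite (bary_affine x 0 c0) subr0 addrC. Qed.

Lemma bary_shift p q r x y z (t : R) : cross p q r != 0 ->
  bary p q r (x + t *: (y - z)) =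
  bary p q r x + t * (bary p q r y - bary p q r z).
Proof.
move=> c0; rewrite (baryE0 (x + _) c0) (baryE0 x c0) (baryE0 y c0) (baryE0 z c0).
by rewrite dotDr dotZr dotDr dotNr; ring.
Qed.

Lemma continuous_bary p q r : cross p q r != 0 ->
  continuous (bary p q r).
Proof.
move=> c0; rewrite (_ : bary p q r = fun x => dot (bary_grad p q r) x + bary p q r 0).
  move=> x; apply: (@cvgD _ _ _ (nbhs x)); first exact: continuous_dot.
  exact: cvg_cst.
by apply/funext => x; exact: baryE0.
Qed.

Lemma bary_vertex p q r : cross p q r != 0 ->
  [/\ bary p q r p = 1, bary p q r q = 0 & bary p q r r = 0].
Proof.
move=> c0; rewrite /bary divff//; split=> //.
  by rewrite (_ : cross q q r = 0) ?mul0r// /cross; ring.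
by rewrite (_ : cross r q r = 0) ?mul0r// /cross; ring.
Qed.

Section TriangleInterior.
Variables (i j k : 'I_Nv).
Hypotheses (ij : i != j) (ik : i != k) (jk : j != k).
Hypothesis c0 : cross (a i) (a j) (a k) != 0.
Let c1 : cross (a j) (a k) (a i) != 0. Proof. by rewrite cross_rot. Qed.
Let c2 : cross (a k) (a i) (a j) != 0. Proof. by rewrite cross_rot. Qed.
Notation K := [set i; j; k]%SET.

Lemma closed_conv_hull : closed (conv_hull a K).
Proof.
have -> : conv_hull a K = (bary (a i) (a j) (a k) @^-1` [set t | 0 <= t]) `&`
    (bary (a j) (a k) (a i) @^-1` [set t | 0 <= t]) `&`
    (bary (a k) (a i) (a j) @^-1` [set t | 0 <= t]).
  apply/seteqP; split=> x; first by move=> /(conv_hull3 x ij ik jk c0)[].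
  by move=> [[? ?] ?]; apply/conv_hull3.
apply: closedI; first apply: closedI;
  by apply: preimage_closed; [move=> x _; exact: continuous_bary|exact: closed_ge].
Qed.

Lemma interior_conv_hull x : 0 < bary (a i) (a j) (a k) x ->
  0 < bary (a j) (a k) (a i) x -> 0 < bary (a k) (a i) (a j) x ->
  interior (conv_hull a K) x.
Proof.
move=> x1 x2 x3.
have gt0 p q r : cross p q r != 0 -> 0 < bary p q r x -> \forall y \near x, 0 < bary p q r y.
  move=> c p0; have := @continuous_bary p q r c x; move/(_ [set t | 0 < t]); apply.
  by apply: open_nbhs_nbhs; split; [exact: open_gt|].
near=> y; apply/conv_hull3 => //; split; apply: ltW; near: y; exact: gt0.
Unshelve. all: by end_near. Qed.

Lemma bary_barycenter : bary (a i) (a j) (a k) (barycenter a K) = 3^-1.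
Proof.
rewrite /barycenter sum_set3// !scalerDr baryE//; lra.
Qed.

End TriangleInterior.

Section TriangleGradient.
Variables (i j k : 'I_Nv).
Hypotheses (ij : i != j) (ik : i != k) (jk : j != k).
Hypothesis c0 : cross (a i) (a j) (a k) != 0.
Let c1 : cross (a j) (a k) (a i) != 0. Proof. by rewrite cross_rot. Qed.
Let c2 : cross (a k) (a i) (a j) != 0. Proof. by rewrite cross_rot. Qed.
Notation K := [set i; j; k]%SET.

(** All barycentric coordinates of the barycenter equal 1/3, so it is interior to the element and h
    is affine near it, however h behaves outside. *)
Lemma grad_on_affine (h : 'cV[R]_2 -> R) g c :
  (forall x, conv_hull a K x -> h x = dot g x + c) -> grad_on a K h = g.
Proof.
move=> hE; have nearh : \forall x \near barycenter a K, h x = dot g x + c.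
  have ji : j != i by rewrite eq_sym.
  have [ki kj] : k != i /\ k != j by rewrite !(eq_sym k).
  have : interior (conv_hull a K) (barycenter a K).
    apply: interior_conv_hull => //.
    - by rewrite bary_barycenter.
    - by rewrite -set3_rot bary_barycenter.
    - by rewrite -set3_rot -set3_rot bary_barycenter.
  by apply: filterS => x /hE.
have Dh (l : 'I_2) : 'D_(delta_mx l ord0) h (barycenter a K) = g l 0.
  rewrite (near_eq_derive _ nearh) /derive; apply: cvg_lim => //.
  apply: cvg_near_cst; near=> t.
  have t0 : t != 0 by near: t; exact: nbhs_dnbhs_neq.
  have dot_delta : dot g (delta_mx l ord0) = g l 0.
    rewrite dotE !mxE !andbT; have [->|->] : l = 0 \/ l = 1 := ord2P l.
      by rewrite mulr1 mulr0 addr0.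
    by rewrite mulr1 mulr0 add0r.
  rewrite /= dotDr dotZr -dot_delta opprD addrACA subrr addr0 addrK.
  by rewrite /GRing.scale /= mulrA mulVf// mul1r.
by apply/matrixP => l m; rewrite mxE (ord1 m) Dh.
Unshelve. all: by end_near. Qed.

Lemma height_sqr : height a K i ^- 2 =
  dot (bary_grad (a i) (a j) (a k)) (bary_grad (a i) (a j) (a k)).
Proof.
set G := bary_grad _ _ _; have [b1 b2 b3] := bary_vertex c0.
have G0 : 0 < dot G G.
  apply: dot_gt0; apply/eqP => G0.
  have := bary_affine (a i) (a j) c0; rewrite -/G G0 b1 b2 dotE !mxE !mul0r !addr0.
  by move/eqP; rewrite oner_eq0.
have n0 : 0 < enorm G by rewrite sqrtr_gt0.
have nE : enorm G ^+ 2 = dot G G by rewrite sqr_sqrtr// ltW.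
suff -> : height a K i = (enorm G)^-1 by rewrite exprVn invrK.
rewrite /height set3D1//.
(* The foot of the perpendicular from a i: moving along - G, the coordinate at i drops from 1 to 0
   after this displacement, of length 1 / |G|. *)
pose x0 := a i - (dot G G)^-1 *: G.
apply/le_anti/andP; split.
  apply: ge_inf.
    by exists 0 => _ [x _ <-]; exact: sqrtr_ge0.
  exists x0.
    apply/(aff_hull2 x0 jk c0); rewrite (bary_affine x0 (a i) c0) b1 -/G /x0.
    rewrite addrAC subrr add0r; apply/eqP; rewrite addr_eq0; apply/eqP.
    by rewrite dotNr dotZr mulVf ?opprK ?gt_eqF.
  rewrite /x0 opprB addrCA subrr addr0 /enorm.
  have sG s : dot (s *: G) (s *: G) = s * (s * dot G G).
    by rewrite dotZr; congr (_ * _); exact: dotZl.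
  by rewrite sG mulVf ?gt_eqF// mulr1 sqrtrV// ltW.
apply: lb_le_inf.
  exists (enorm (a i - a j)); exists (a j) => //.
  by apply/(aff_hull2 _ jk c0).
move=> _ [x /(aff_hull2 x jk c0) bx <-].
rewrite -[leLHS]mul1r ler_pdivrMr//.
(* For any x on the opposite line, this and the Cauchy-Schwarz inequality give 1 <= |G| |a i -
   x|. *)
have -> : 1 = dot G (a i - x).
  by have := bary_affine (a i) x c0; rewrite b1 bx add0r.
rewrite /enorm -sqrtrM; last by rewrite dotE -!expr2 addr_ge0 ?sqr_ge0.
rewrite (le_trans (ler_norm _))// -sqrtr_sqr ler_wsqrtr// !dotE.
rewrite -subr_ge0; set u := a i - x.
rewrite [leRHS](_ : _ = (G 0 0 * u 1 0 - G 1 0 * u 0 0) ^+ 2); last by ring.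
exact: sqr_ge0.
Qed.

End TriangleGradient.
End TriangleTopology.

(** * Consequences of conformity *)

Section Triangulation.
Variables (R : realType) (Nv : nat) (a : 'I_Nv -> 'cV[R]_2).
Variables (Th : {set {set 'I_Nv}}) (Omega : set 'cV[R]_2).
Hypothesis mesh : triangulation a Th Omega.
Implicit Types (x y : 'cV[R]_2) (i j k l : 'I_Nv) (K : {set 'I_Nv}).

Lemma edge_element K i j : K \in Th -> i \in K -> j \in K -> i != j ->
  exists k, [/\ K = [set i; j; k]%SET, i != k, j != k & cross (a i) (a j) (a k) != 0].
Proof.
move=> KTh iK jK ij.
have /cards1P[k kE] : #|(K :\ i) :\ j|%SET == 1%N.
  have := mesh_card mesh KTh; rewrite (cardsD1 i) iK (cardsD1 j) !inE eq_sym ij jK /=.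
  by rewrite !add1n => -[->].
exists k.
have : k \in ((K :\ i) :\ j)%SET by rewrite kE inE.
rewrite !inE => /and3P[kj ki kK].
have KE : K = [set i; j; k]%SET.
  apply/setP => l; rewrite !inE.
  have [->|li] := eqVneq l i; first by rewrite iK.
  have [->|lj] := eqVneq l j; first by rewrite jK.
  have : (l \in (K :\ i) :\ j)%SET = (l == k) by rewrite kE inE.
  by rewrite !inE li lj.
have [ik jk] : i != k /\ j != k by rewrite eq_sym ki eq_sym kj.
split => //; apply: cross_neq0 => //; rewrite -KE => l lK.
exact: (mesh_nondegenerate mesh KTh lK).
Qed.

Lemma vertex_element K i : K \in Th -> i \in K -> exists j k,
  [/\ K = [set i; j; k]%SET, i != j, i != k, j != k & cross (a i) (a j) (a k) != 0].
Proof.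
move=> KTh iK.
have : (0 < #|K :\ i|)%N.
  by have := mesh_card mesh KTh; rewrite (cardsD1 i) iK add1n => -[->].
case/card_gt0P => j; rewrite !inE => /andP[ji jK].
have [|k [KE ik jk c0]] := edge_element KTh iK jK; first by rewrite eq_sym.
by exists j, k; split; rewrite // eq_sym.
Qed.

(** By conformity a point common to two elements lies in the hull of their common vertices; once in
    an affine hull of two vertices, it has a vanishing barycentric coordinate by [aff_hull2]. *)
Lemma conv_hull_sub_aff (S T : {set 'I_Nv}) x : S \subset T ->
  conv_hull a S x -> aff_hull a T x.
Proof.
move=> ST [w [_ w1 xE]]; exists (fun l => if l \in S then w l else 0).
have sub (V : nmodType) (F : 'I_Nv -> V) :
    \sum_(l in T) (if l \in S then F l else 0) = \sum_(l in S) F l.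
  rewrite [RHS]big_mkcond [LHS]big_mkcond; apply: eq_bigr => l _.
  by have [lS|] := boolP (l \in S); [rewrite (fintype.subsetP ST)|case: ifP].
split; first by rewrite sub.
rewrite xE -sub; apply: eq_bigr => l _.
by case: ifP => // _; rewrite scale0r.
Qed.

(* Otherwise some point near the edge lies in both triangles, but not in the
   hull of their common vertices. *)
Lemma opposite_sides i j k k' : k != k' -> i != j -> i != k -> j != k ->
  i != k' -> j != k' -> [set i; j; k]%SET \in Th -> [set i; j; k']%SET \in Th ->
  cross (a i) (a j) (a k) != 0 -> cross (a i) (a j) (a k') != 0 ->
  cross (a i) (a j) (a k) * cross (a i) (a j) (a k') < 0.
Proof.
move=> kk' ij ik jk ik' jk' KTh KTh' c0 c0'.
rewrite ltNge; apply/negP => cc.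
have cc0 : 0 < cross (a i) (a j) (a k) * cross (a i) (a j) (a k').
  by rewrite lt_neqAle cc andbT eq_sym mulf_neq0.
(* The barycentric coordinate at k of the vertex a k'; it is positive when a k' is on the same side
   of the edge as a k. *)
pose s := cross (a i) (a j) (a k') / cross (a i) (a j) (a k).
have s0 : 0 < s.
  have c20 : 0 < cross (a i) (a j) (a k) ^+ 2 by rewrite exprn_even_gt0.
  by rewrite -(pmulr_lgt0 _ c20) /s expr2 mulrA mulfVK// mulrC.
pose b := bary (a i) (a j) (a k) (a k'); pose c := bary (a j) (a k) (a i) (a k').
(* Chosen so that the weight m = (1 - e) / 2 equals e (|b| + |c|); hence m + e b and m + e c, the
   coordinates of z at i and j in the first triangle, are nonnegative. *)
pose e := (1 + 2 * `|b| + 2 * `|c|)^-1.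
have [nb nc] := (normr_ge0 b, normr_ge0 c).
have den0 : 0 < 1 + 2 * `|b| + 2 * `|c| by lra.
have e0 : 0 < e by rewrite invr_gt0.
have eE : e + 2 * (e * `|b|) + 2 * (e * `|c|) = 1.
  by rewrite -[RHS](mulVf (lt0r_neq0 den0)) -/e; ring.
have eb0 : 0 <= e * `|b| by rewrite mulr_ge0// ltW.
have ec0 : 0 <= e * `|c| by rewrite mulr_ge0// ltW.
have eb : - (e * `|b|) <= e * b by rewrite -mulrN ler_pM2l// lerNl -normrN ler_norm.
have ec : - (e * `|c|) <= e * c by rewrite -mulrN ler_pM2l// lerNl -normrN ler_norm.
pose m := (1 - e) / 2.
pose z := m *: a i + m *: a j + e *: a k'.
have mme : m + m + e = 1 by rewrite /m; lra.
have c1 : cross (a j) (a k) (a i) != 0 by rewrite cross_rot.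
have c2 : cross (a k) (a i) (a j) != 0 by rewrite cross_rot.
have c1' : cross (a j) (a k') (a i) != 0 by rewrite cross_rot.
have c2' : cross (a k') (a i) (a j) != 0 by rewrite cross_rot.
have baryz p q r : cross p q r != 0 ->
    bary p q r z = m * bary p q r (a i) + m * bary p q r (a j) + e * bary p q r (a k').
  move=> cpqr; rewrite (baryE0 z) // (baryE0 (a i)) // (baryE0 (a j)) //.
  rewrite (baryE0 (a k')) // /z !dotDr !dotZr.
  by rewrite -[X in _ + X = _]mul1r -mme; ring.
have zK : conv_hull a [set i; j; k]%SET z.
  apply/conv_hull3 => //; rewrite !baryz//.
  have [v1 v2 v3] := bary_vertex c0; have [v4 v5 v6] := bary_vertex c1.
  have [v7 v8 v9] := bary_vertex c2.
  rewrite v1 v2 v4 v6 v8 v9 -/b -/c; split.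
  - by rewrite /m; lra.
  - by rewrite /m; lra.
  - rewrite !mulr0 !add0r mulr_ge0 ?ltW//.
    rewrite /bary -(cross_rot (a k')) -(cross_rot (a k)).
    exact: s0.
have m0 : 0 <= m by rewrite /m; lra.
have v1 : [/\ bary (a i) (a j) (a k') z = m, bary (a j) (a k') (a i) z = m &
    bary (a k') (a i) (a j) z = e].
  have [v1 v2 v3] := bary_vertex c0'; have [v4 v5 v6] := bary_vertex c1'.
  have [v7 v8 v9] := bary_vertex c2'.
  by rewrite !baryz// v1 v2 v3 v4 v5 v6 v7 v8 v9; split; ring.
have zK' : conv_hull a [set i; j; k']%SET z.
  by apply/conv_hull3 => //; have [-> -> ->] := v1; rewrite m0 ltW.
have : (conv_hull a [set i; j; k]%SET `&` conv_hull a [set i; j; k']%SET) z by [].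
rewrite (mesh_conforming mesh)//.
have -> : ([set i; j; k] :&: [set i; j; k'] = [set i; j])%SET.
  apply/setP => l; rewrite !inE; have [->|li] := eqVneq l i => //=.
  have [->|lj] := eqVneq l j => //=; apply/negP => /andP[/eqP -> /eqP].
  by move/eqP: kk'.
move=> /(conv_hull_sub_aff (subxx _))/(aff_hull2 _ ij c2').
by have [_ _ ->] := v1 => /eqP; rewrite gt_eqF.
Qed.

End Triangulation.

(** * Edges at interior vertices *)

Section InteriorEdge.
Variables (R : realType) (Nv : nat) (a : 'I_Nv -> 'cV[R]_2).
Variables (Th : {set {set 'I_Nv}}) (Omega : set 'cV[R]_2).
Hypothesis mesh : triangulation a Th Omega.
Implicit Types (x y v : 'cV[R]_2) (i j k l : 'I_Nv) (K : {set 'I_Nv}).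

Lemma near_along x v (P : set 'cV[R]_2) : nbhs x P ->
  exists2 e : R, 0 < e & forall t : R, 0 < t < e -> P (x + t *: v).
Proof.
move=> xP.
have cv : (fun t : R => x + t *: v) t @[t --> (0:R)] --> x.
  rewrite -[X in _ --> X]addr0 -[X in _ + X](scale0r v).
  apply: cvgD; first exact: cvg_cst.
  by apply: cvgZr_tmp; exact: cvg_id.
have /nbhs_ballP[e e0 eP] := cv _ xP.
exists e => // t /andP[t0 te]; apply: (eP t).
by rewrite /ball/= sub0r normrN gtr0_norm.
Qed.

(* A point of the edge close to [a i] is in Omega; the elements covering the
   points just across the edge contain it, because elements are closed. *)
Lemma across_edge i j k : Omega (a i) -> [set i; j; k]%SET \in Th ->
  i != j -> i != k -> j != k -> cross (a i) (a j) (a k) != 0 ->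
  exists k', [/\ k' != k, [set i; j; k']%SET \in Th, i != k', j != k' &
    cross (a i) (a j) (a k') != 0].
Proof.
move=> Oi KTh ij ik jk c0.
have c1 : cross (a j) (a k) (a i) != 0 by rewrite cross_rot.
have c2 : cross (a k) (a i) (a j) != 0 by rewrite cross_rot.
have closedK K : K \in Th -> closed (conv_hull a K).
  move=> KTh'; have [K0|[l lK]] := set_0Vmem K.
    by have := mesh_card mesh KTh'; rewrite K0 cards0.
  have [m [n [-> lm ln mn cK]]] := vertex_element mesh KTh' lK.
  exact: closed_conv_hull.
have nO : nbhs (a i) Omega by apply: open_nbhs_nbhs; split => //; exact: domain_open mesh.
have [e e0 eO] := near_along (a j - a i) nO.
(* Below e to keep x in Omega, and strictly between 0 and 1 to keep x away from both endpoints. *)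
pose s := Num.min e 1 / 2.
have s0 : 0 < s by rewrite divr_gt0// lt_min e0 ltr01.
have [se s1] : s < e /\ s < 1.
  have : Num.min e 1 <= e /\ Num.min e 1 <= 1 by rewrite !ge_min !lexx orbT.
  by rewrite /s; move: s0; rewrite /s => s0 [h1 h2]; split; lra.
pose x := a i + s *: (a j - a i).
have Ox : Omega x by apply: eO; rewrite s0 se.
have nx : \forall y \near x, Omega y /\ forall K, K \in Th -> conv_hull a K y -> conv_hull a K x.
  near=> y; split; first by near: y; apply: open_nbhs_nbhs; split => //; exact: domain_open mesh.
  near: y; apply: filter_forall => K.
  have [KT|KT] := boolP (K \in Th); last by near=> y.
  have [xK|xK] := pselect (conv_hull a K x); first by near=> y.
  near=> y => _ yK; exfalso; have : (~` conv_hull a K) y.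
    near: y; apply: open_nbhs_nbhs; split => //.
    by apply: closed_openC; exact: closedK.
  by [].
have [d d0 dP] := near_along (a i - a k) nx.
pose t := d / 2.
have t0 : 0 < t by rewrite divr_gt0.
have td : t < d by rewrite /t; lra.
have [Oy yK] := dP t (introT andP (conj t0 td)).
set y := x + t *: (a i - a k) in Oy yK.
have : closure Omega y by exact: subset_closure.
rewrite (mesh_cover mesh) => -[K' /= K'Th yK'].
have xK' := yK _ K'Th yK'.
have [v1 v2 v3] := bary_vertex c0; have [v4 v5 v6] := bary_vertex c1.
have [v7 v8 v9] := bary_vertex c2.
have bxk : bary (a k) (a i) (a j) x = 0.
  by rewrite bary_shift// v8 v9 subrr mulr0 addr0.
have bxi : bary (a i) (a j) (a k) x = 1 - s.
  by rewrite bary_shift// v1 v2 sub0r mulrN1.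
have bxj : bary (a j) (a k) (a i) x = s.
  by rewrite bary_shift// v4 v6 subr0 mulr1 add0r.
have byk : bary (a k) (a i) (a j) y = - t.
  by rewrite bary_shift// bxk v7 v8 sub0r mulrN1 add0r.
have xK : conv_hull a [set i; j; k]%SET x.
  by apply/conv_hull3 => //; rewrite bxk bxi bxj; split=> //; lra.
have KK' : K' <> [set i; j; k]%SET.
  move=> KE; move: yK'; rewrite KE => /(conv_hull3 _ ij ik jk c0)[_ _].
  by rewrite byk oppr_ge0 leNgt t0.
(* The common point x has coordinates 1 - s at i and s at j, both nonzero, so i and j must be among
   the common vertices. *)
have : (conv_hull a [set i; j; k]%SET `&` conv_hull a K') x by [].
rewrite (mesh_conforming mesh)// => xI.
have iK' : i \in K'.
  apply/negPn/negP => iK'.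
  have : ([set i; j; k] :&: K' \subset [set j; k])%SET.
    apply/fintype.subsetP => l; rewrite !inE => /andP[/orP[/orP[]/eqP->|/eqP->] lK'];
      rewrite ?eqxx ?orbT//.
    by rewrite lK' in iK'.
  move=> /conv_hull_sub_aff/(_ xI)/(aff_hull2 _ jk c0).
  by rewrite bxi; lra.
have jK' : j \in K'.
  apply/negPn/negP => jK'.
  have : ([set i; j; k] :&: K' \subset [set k; i])%SET.
    apply/fintype.subsetP => l; rewrite !inE => /andP[/orP[/orP[]/eqP->|/eqP->] lK'];
      rewrite ?eqxx ?orbT//.
    by rewrite lK' in jK'.
  have ki : k != i by rewrite eq_sym.
  move=> /conv_hull_sub_aff/(_ xI)/(aff_hull2 _ ki c1).
  by rewrite bxj; lra.
have [k' [KE ik' jk' c0']] := edge_element mesh K'Th iK' jK' ij.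
exists k'; split => //; last by rewrite -KE.
by apply/eqP => kk; apply: KK'; rewrite KE kk.
Unshelve. all: by end_near. Qed.

(** A third element on the edge would give three signed areas whose pairwise products are all
    negative. *)
Lemma edge_elements i j k : Omega (a i) -> [set i; j; k]%SET \in Th ->
  i != j -> i != k -> j != k -> cross (a i) (a j) (a k) != 0 ->
  exists k', [/\ interior_edge a Th Omega i j k k', i != k', j != k',
    cross (a i) (a j) (a k') != 0 &
    [set K in Th | (i \in K) && (j \in K)]%SET =
      [set [set i; j; k]; [set i; j; k']]%SET /\
    [set i; j; k]%SET != [set i; j; k']%SET].
Proof.
move=> Oi KTh ij ik jk c0.
have [k' [kk' K'Th ik' jk' c0']] := across_edge Oi KTh ij ik jk c0.
have KK' : [set i; j; k]%SET != [set i; j; k']%SET.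
  apply/eqP => /setP/(_ k); rewrite !inE eqxx orbT (eq_sym k) (negbTE ik).
  by rewrite (eq_sym k) (negbTE jk) eq_sym (negbTE kk').
exists k'; split => //.
  (* The edge contains a i, which lies in the open set Omega and hence not on its boundary. *)
  rewrite /interior_edge eq_sym kk' KTh K'Th /=; apply/asboolPn => /(_ (a i)) h.
  have [_] : boundary Omega (a i).
    apply: h; exists (fun l => (l == i)%:R).
    rewrite !sum_set2// eqxx eq_sym (negbTE ij) addr0 scale1r scale0r addr0.
    by split => // l _; rewrite ler0n.
  apply; have := domain_open mesh; rewrite openE; exact.
split => //; apply/setP => K; rewrite !inE; apply/idP/idP; last first.
  by case/orP => /eqP->; rewrite ?KTh ?K'Th !inE !eqxx ?orbT.
case/and3P => KT iK jK.
have [m [KE im jm cm]] := edge_element mesh KT iK jK ij.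
have [mk|mk] := eqVneq m k; first by rewrite KE mk eqxx.
have [mk'|mk'] := eqVneq m k'; first by rewrite KE mk' eqxx orbT.
have KT' : [set i; j; m]%SET \in Th by rewrite -KE.
have h1 := opposite_sides mesh mk ij im jm ik jk KT' KTh cm c0.
have h2 := opposite_sides mesh mk' ij im jm ik' jk' KT' K'Th cm c0'.
have h3 := opposite_sides mesh kk' ij ik' jk' ik jk K'Th KTh c0' c0.
exfalso; set A := cross _ _ (a m) in h1 h2; set B := cross _ _ (a k) in h1 h3.
set C := cross _ _ (a k') in h2 h3.
have : 0 < (A * B) * (A * C) by rewrite nmulr_rgt0.
have -> : (A * B) * (A * C) = A ^+ 2 * (C * B) by ring.
by rewrite ltNge mulr_ge0_le0 ?sqr_ge0// ltW.
Qed.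

End InteriorEdge.

(** * Integrals over an element *)

Section TriangleMeasure.
Variable R : realType.
Implicit Types (p q r : 'cV[R]_2) (z : R * R).
Notation leb2 := (@leb2 R).
Notation mR2 := (measurableTypeR R * measurableTypeR R)%type.

(* [triangle] and [bary_affine2] live on [R * R], where the measure is. *)
Definition triangle p q r : set (R * R) :=
  [set z | [/\ 0 <= bary p q r (pt z), 0 <= bary q r p (pt z) & 0 <= bary r p q (pt z)]].

Lemma pt0 z : pt z 0 0 = z.1. Proof. by rewrite mxE. Qed.
Lemma pt1 z : pt z 1 0 = z.2. Proof. by rewrite mxE. Qed.

Definition bary_affine2 p q r : mR2 -> mR2 :=
  affine2 ((q 1 0 - r 1 0) / cross p q r) ((r 0 0 - q 0 0) / cross p q r)
          ((q 0 0 * r 1 0 - q 1 0 * r 0 0) / cross p q r)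
          ((r 1 0 - p 1 0) / cross p q r) ((p 0 0 - r 0 0) / cross p q r)
          ((r 0 0 * p 1 0 - r 1 0 * p 0 0) / cross p q r).

Lemma bary_affine2E p q r z :
  bary_affine2 p q r z = (bary p q r (pt z), bary q r p (pt z)).
Proof.
rewrite /bary_affine2 /affine2 /bary (cross_rot p q r) /cross !pt0 !pt1; congr pair; ring.
Qed.

Lemma triangleE p q r : cross p q r != 0 ->
  triangle p q r = bary_affine2 p q r @^-1` @ref_triangle R.
Proof.
move=> c0; apply/seteqP; split => z; rewrite /preimage/mkset bary_affine2E.
  move=> [z1 z2 z3]; split; [split|] => //=.
  by have := bary_sum (pt z) c0; lra.
move=> [[/= z1 z2] z3]; split => //.
by move: z3; have := bary_sum (pt z) c0 => /=; lra.
Qed.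

Lemma bary_affine2_det p q r : cross p q r != 0 ->
  (q 1 0 - r 1 0) / cross p q r * ((p 0 0 - r 0 0) / cross p q r)
  - (r 1 0 - p 1 0) / cross p q r * ((r 0 0 - q 0 0) / cross p q r) =
  (cross p q r)^-1.
Proof. by move=> c0; rewrite /cross; field; exact: c0. Qed.

Lemma leb2_preimage_bary p q r (A : set mR2) : cross p q r != 0 -> measurable A ->
  leb2 (bary_affine2 p q r @^-1` A) = (`|cross p q r|%:E * leb2 A)%E.
Proof.
move=> c0 mA; rewrite /bary_affine2 leb2_preimage_affine2 ?bary_affine2_det ?invr_neq0//.
by rewrite normfV invrK.
Qed.

Lemma measurable_triangle p q r : cross p q r != 0 -> measurable (triangle p q r : set mR2).
Proof.
move=> c0; rewrite triangleE//; apply: measurable_preimage_affine2.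
exact: measurable_ref_triangle.
Qed.

Lemma measurable_bary p q r : measurable_fun setT (fun z : mR2 => bary p q r (pt z)).
Proof.
rewrite (_ : (fun z => _) = fst \o bary_affine2 p q r).
  by apply: measurableT_comp => //; exact: measurable_affine2.
by apply/funext => z; rewrite -[RHS]/((bary_affine2 p q r z).1) bary_affine2E.
Qed.

Lemma leb2_bary_eq0 p q r : cross p q r != 0 ->
  leb2 [set z | bary p q r (pt z) = 0] = 0.
Proof.
move=> c0.
rewrite (_ : [set z | _] = bary_affine2 p q r @^-1` ([set 0] `*` setT)); last first.
  apply/seteqP; split => z; rewrite /preimage/mkset bary_affine2E.
    by move=> z0; split.
  by case.
rewrite leb2_preimage_bary//; last by apply: measurableX.
by rewrite [X in (_ * X)%E]product_measure1E//= lebesgue_measure_set1 mul0e mule0.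
Qed.

(** The map [bary_affine2] has determinant 1 / cross: the triangle is its preimage of
    [ref_triangle], and it pushes the plane measure forward to |cross| times itself. *)
Lemma integral_triangle p q r k : cross p q r != 0 ->
  (\int[leb2]_(z in triangle p q r) ((1 - bary p q r (pt z)) ^+ k)%:E =
   (`|cross p q r| / k.+2%:R)%:E)%E.
Proof.
move=> c0; have mT : measurable_fun setT (bary_affine2 p q r) by exact: measurable_affine2.
rewrite triangleE//.
transitivity (\int[leb2]_(z in bary_affine2 p q r @^-1` @ref_triangle R)
   ((fun w : mR2 => ((1 - w.1) ^+ k)%:E) \o bary_affine2 p q r) z)%E.
  apply: eq_integral => z _.
  by rewrite (_ : bary p q r (pt z) = (bary_affine2 p q r z).1)// bary_affine2E.
rewrite -(ge0_integral_pushforward mT leb2); last 3 first.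
- exact: measurable_ref_triangle.
- by apply: measurable_funTS; apply/measurable_EFinP; exact: measurable_onemX.
- move=> w; rewrite inE => -[[w1 w2] w12]; rewrite lee_fin exprn_ge0//.
  by move: w1 w2 w12 => /=; lra.
pose c : {nonneg R} := NngNum (normr_ge0 (cross p q r)).
rewrite (eq_measure_integral (mscale c leb2)); last first.
  by move=> A mA _; exact: leb2_preimage_bary.
rewrite ge0_integral_mscale//.
- by rewrite integral_ref_triangle -EFinM.
- exact: measurable_ref_triangle.
- by apply: measurable_funTS; apply/measurable_EFinP; exact: measurable_onemX.
- move=> w [[w1 w2] w12]; rewrite lee_fin exprn_ge0//.
  by move: w1 w2 w12 => /=; lra.
Qed.

Lemma leb2_triangle p q r : cross p q r != 0 ->
  leb2 (triangle p q r) = (`|cross p q r| / 2)%:E.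
Proof.
move=> c0; rewrite -(integral_triangle 0 c0).
under eq_integral do rewrite expr0.
by rewrite integral_cst ?mul1e//; exact: measurable_triangle.
Qed.

Lemma integrable_onem_bary p q r k : cross p q r != 0 ->
  leb2.-integrable (triangle p q r) (fun z => ((1 - bary p q r (pt z)) ^+ k)%:E).
Proof.
move=> c0; apply/integrableP; split.
  apply: measurable_funTS; apply/measurable_EFinP; apply: measurable_funX.
  by apply: measurable_funB => //; exact: measurable_bary.
under eq_integral => z.
  rewrite inE => -[z1 z2 z3]; rewrite abse_EFin ger0_norm; last first.
    by rewrite exprn_ge0//; have := bary_sum (pt z) c0; lra.
  over.
by rewrite integral_triangle// ltry.
Qed.

Lemma Rintegral_onem_bary p q r k : cross p q r != 0 ->
  \int[leb2]_(z in triangle p q r) ((1 - bary p q r (pt z)) ^+ k) = `|cross p q r| / k.+2%:R.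
Proof. by move=> c0; rewrite /Rintegral integral_triangle. Qed.

(** Linearity of the integral requires integrability, so the two are carried together. *)
Let has_int (D : set mR2) (f : mR2 -> R) (v : R) :=
  leb2.-integrable D (EFin \o f) /\ \int[leb2]_(z in D) f z = v.

Let has_intD D f g v w : measurable D -> has_int D f v -> has_int D g w ->
  has_int D (fun z => f z + g z) (v + w).
Proof.
move=> mD [fi fv] [gi gw]; split; last by rewrite RintegralD// fv gw.
by rewrite (_ : _ \o _ = (EFin \o f) \+ (EFin \o g))%E//; exact: integrableD.
Qed.

Let has_intZ D f v (s : R) : measurable D -> has_int D f v ->
  has_int D (fun z => s * f z) (s * v).
Proof.
move=> mD [fi fv]; split; last by rewrite RintegralZl// fv.
by rewrite (_ : _ \o _ = fun z => s%:E * (EFin \o f) z)%E//; exact: integrableZl.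
Qed.

Let has_int_bary2 p q r : cross p q r != 0 ->
  has_int (triangle p q r) (fun z => bary p q r (pt z) * bary p q r (pt z))
    (`|cross p q r| / 12).
Proof.
move=> c0; have mt := measurable_triangle c0.
have h k : has_int (triangle p q r) (fun z => (1 - bary p q r (pt z)) ^+ k)
    (`|cross p q r| / k.+2%:R).
  by split; [exact: integrable_onem_bary|exact: Rintegral_onem_bary].
(* With b the coordinate, b^2 = (1 - b)^2 - 2 (1 - b) + 1, and 1/4 - 2/3 + 1/2 = 1/12. *)
have := has_intD mt (has_intD mt (h 2%N) (has_intZ (-2) mt (h 1%N))) (h 0%N).
rewrite (_ : (fun z => _) = fun z => bary p q r (pt z) * bary p q r (pt z)).
  by congr has_int; field.
by apply/funext => z; ring.
Qed.

Lemma triangle_rot p q r : triangle q r p = triangle p q r.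
Proof. by apply/seteqP; split => z -[]. Qed.

Lemma Rintegral_bary2 p q r : cross p q r != 0 ->
  \int[leb2]_(z in triangle p q r) (bary p q r (pt z) * bary p q r (pt z)) =
  `|cross p q r| / 12.
Proof. by move=> /has_int_bary2[]. Qed.

Lemma Rintegral_bary_bary p q r : cross p q r != 0 ->
  \int[leb2]_(z in triangle p q r) (bary p q r (pt z) * bary q r p (pt z)) =
  `|cross p q r| / 24.
Proof.
move=> c0; have mt := measurable_triangle c0.
have c1 : cross q r p != 0 by rewrite cross_rot.
have c2 : cross r p q != 0 by rewrite cross_rot.
have h0 := has_int_bary2 c0.
have := has_int_bary2 c1; rewrite triangle_rot (cross_rot p q r) => h1.
have h2 : has_int (triangle p q r) (fun z => (1 - bary r p q (pt z)) ^+ 2)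
    (`|cross p q r| / 4).
  by rewrite -(cross_rot p q r) -(cross_rot q r p) -(triangle_rot p q r)
    -(triangle_rot q r p); split; [exact: integrable_onem_bary|exact: Rintegral_onem_bary].
(* Polarization: u v = ((u + v)^2 - u^2 - v^2) / 2 with u + v = 1 - w, and (1/4 - 1/12 - 1/12) / 2 =
   1/24. *)
have := has_intZ 2^-1 mt (has_intD mt h2 (has_intZ (-1) mt (has_intD mt h0 h1))).
rewrite (_ : (fun z => _) = fun z => bary p q r (pt z) * bary q r p (pt z)).
  by case=> _ ->; field.
apply/funext => z; have := bary_sum (pt z) c0.
move: (bary p q r _) (bary q r p _) (bary r p q _) => u v w uvw.
by rewrite (_ : 1 - w = u + v); [field|rewrite -uvw; ring].
Qed.

End TriangleMeasure.

(** * Discarding the edges of a triangle *)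

Section OpenTriangle.
Variable R : realType.
Implicit Types (p q r : 'cV[R]_2) (z : R * R).
Notation leb2 := (@leb2 R).
Notation mR2 := (measurableTypeR R * measurableTypeR R)%type.

Definition open_triangle p q r : set (R * R) :=
  [set z | [/\ 0 < bary p q r (pt z), 0 < bary q r p (pt z) & 0 < bary r p q (pt z)]].

Definition triangle_lines p q r : set (R * R) :=
  [set z | bary p q r (pt z) = 0] `|` [set z | bary q r p (pt z) = 0]
  `|` [set z | bary r p q (pt z) = 0].

Lemma open_triangleE p q r : open_triangle p q r = triangle p q r `\` triangle_lines p q r.
Proof.
apply/seteqP; split => z.
  move=> [z1 z2 z3]; split; first by split; apply: ltW.
  by move=> [[]|] /= z0; rewrite z0 ltxx in z1 z2 z3.
move=> [[z1 z2 z3] /not_orP[/not_orP[/eqP n1 /eqP n2] /eqP n3]].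
by split; rewrite lt_neqAle eq_sym ?n1 ?n2 ?n3.
Qed.

Lemma measurable_line p q r : measurable ([set z | bary p q r (pt z) = 0] : set mR2).
Proof.
rewrite (_ : [set z | _] = (fun z : mR2 => bary p q r (pt z)) @^-1` [set 0])//.
by rewrite -[X in measurable X]setTI; apply: measurable_bary.
Qed.

Lemma measurable_triangle_lines p q r : measurable (triangle_lines p q r : set mR2).
Proof. by apply: measurableU; [apply: measurableU|]; exact: measurable_line. Qed.

Lemma leb2_triangle_lines p q r : cross p q r != 0 -> leb2 (triangle_lines p q r) = 0.
Proof.
move=> c0; have c1 : cross q r p != 0 by rewrite cross_rot.
have c2 : cross r p q != 0 by rewrite cross_rot.
rewrite [LHS](measureU0 (mu := leb2)) //.
- rewrite [LHS](measureU0 (mu := leb2)) //; [exact: leb2_bary_eq0|..|exact: leb2_bary_eq0];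
    exact: measurable_line.
- by apply: measurableU; exact: measurable_line.
- exact: measurable_line.
- exact: leb2_bary_eq0.
Qed.

Lemma measurable_open_triangle p q r : cross p q r != 0 ->
  measurable (open_triangle p q r : set mR2).
Proof.
move=> c0; rewrite open_triangleE; apply: measurableD.
  exact: measurable_triangle.
exact: measurable_triangle_lines.
Qed.

(* The hypotheses on [D] and [f] hold in Omega, hence only in the interior of an
   element, so the edges have to be discarded. *)
Lemma Rintegral_open_triangle p q r (f : R * R -> R) : cross p q r != 0 ->
  leb2.-integrable (triangle p q r) (EFin \o f) ->
  \int[leb2]_(z in triangle p q r) f z = \int[leb2]_(z in open_triangle p q r) f z.
Proof.
move=> c0 fi; rewrite /Rintegral open_triangleE; congr fine.
exact: (negligible_integral (measurable_triangle_lines p q r)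
  (measurable_triangle c0) fi (leb2_triangle_lines c0)).
Qed.

Lemma leb2_open_triangle p q r : cross p q r != 0 ->
  leb2 (open_triangle p q r) = (`|cross p q r| / 2)%:E.
Proof.
move=> c0; rewrite -leb2_triangle//.
have mo := measurable_open_triangle c0.
rewrite [in RHS](_ : triangle p q r =
    open_triangle p q r `|` (triangle p q r `&` triangle_lines p q r)); last first.
  by rewrite open_triangleE setUC setUIDK.
rewrite [RHS](measureU0 (mu := leb2))//.
  apply: measurableI; first exact: measurable_triangle.
  exact: measurable_triangle_lines.
apply: (subset_measure0 (mu := leb2) _ _ _ (leb2_triangle_lines c0)); last exact: subIsetr.
  apply: measurableI; first exact: measurable_triangle.
  exact: measurable_triangle_lines.
exact: measurable_triangle_lines.
Qed.

(** A zero integral would make f vanish almost everywhere on the open triangle, where it is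
    positive; but the open triangle has positive measure. *)
Lemma Rintegral_triangle_gt0 p q r (f : R * R -> R) : cross p q r != 0 ->
  leb2.-integrable (triangle p q r) (EFin \o f) ->
  (forall z, open_triangle p q r z -> 0 < f z) ->
  0 < \int[leb2]_(z in triangle p q r) f z.
Proof.
move=> c0 fi f0; rewrite Rintegral_open_triangle//.
rewrite lt_neqAle Rintegral_ge0 ?andbT; last by move=> z /f0/ltW.
apply/eqP => I0.
have mo := measurable_open_triangle c0.
have fio : leb2.-integrable (open_triangle p q r) (EFin \o f).
  apply: integrableS fi => //; first exact: measurable_triangle.
  by rewrite open_triangleE; exact: subDsetl.
have : (\int[leb2]_(z in open_triangle p q r) `|(EFin \o f) z| = 0)%E.
  transitivity (\int[leb2]_(z in open_triangle p q r) (EFin \o f) z)%E.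
    apply: eq_integral => z; rewrite inE => zo.
    by rewrite /= gtr0_norm// f0.
  by rewrite -[LHS]fineK; [rewrite [RHS](congr1 EFin I0)|exact: integrable_fin_num].
move/(ae_eq_integral_abs leb2 mo (measurable_int _ fio)) => [N [mN N0 subN]].
have : leb2 (open_triangle p q r) = 0.
  apply: (subset_measure0 (mu := leb2) mo mN _ N0) => z zo; apply: subN => /= /(_ zo) [fz].
  by have := f0 z zo; rewrite fz ltxx.
rewrite leb2_open_triangle// => -[] /eqP.
by rewrite mulf_eq0 invr_eq0 normr_eq0 (negbTE c0)/= pnatr_eq0.
Qed.

End OpenTriangle.

(** * Hat functions on one element *)

Section Element.
Variables (R : realType) (Nv : nat) (a : 'I_Nv -> 'cV[R]_2).
Implicit Types (x y : 'cV[R]_2) (i j k l : 'I_Nv) (K : {set 'I_Nv}).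

Lemma preimage_conv_hull i j k : i != j -> i != k -> j != k ->
  cross (a i) (a j) (a k) != 0 ->
  @pt R @^-1` conv_hull a [set i; j; k]%SET = triangle (a i) (a j) (a k).
Proof.
move=> ij ik jk c0; apply/seteqP; split => z /=.
  by move=> /(conv_hull3 _ ij ik jk c0).
by move=> ?; apply/conv_hull3.
Qed.

Lemma area_conv_hull i j k : i != j -> i != k -> j != k ->
  cross (a i) (a j) (a k) != 0 ->
  area (conv_hull a [set i; j; k]%SET) = `|cross (a i) (a j) (a k)| / 2.
Proof. by move=> *; rewrite /area preimage_conv_hull// leb2_triangle. Qed.

Variables (Th : {set {set 'I_Nv}}) (Omega : set 'cV[R]_2).
Hypothesis mesh : triangulation a Th Omega.

Lemma open_triangle_Omega i j k z : i != j -> i != k -> j != k ->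
  cross (a i) (a j) (a k) != 0 -> [set i; j; k]%SET \in Th ->
  open_triangle (a i) (a j) (a k) z -> Omega (pt z).
Proof.
move=> ij ik jk c0 KTh [z1 z2 z3]; apply: (mesh_interior mesh KTh).
exact: interior_conv_hull.
Qed.

Lemma area_gt0 K : K \in Th -> 0 < area (conv_hull a K).
Proof.
move=> KTh; have [K0|[l lK]] := set_0Vmem K.
  by have := mesh_card mesh KTh; rewrite K0 cards0.
have [m [n [-> lm ln mn c0]]] := vertex_element mesh KTh lK.
by rewrite area_conv_hull// divr_gt0// normr_gt0.
Qed.

Variable phi : 'I_Nv -> 'cV[R]_2 -> R.
Hypothesis hat : is_hat_basis a Th Omega phi.

Lemma conv_hull_vertex K i : i \in K -> conv_hull a K (a i).
Proof.
move=> iK; exists (fun l => (l == i)%:R); split.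
- by move=> l _; rewrite ler0n.
- by rewrite (bigD1 i)//= eqxx big1 ?addr0// => l /andP[_ /negbTE->].
- rewrite (bigD1 i)//= eqxx scale1r big1 ?addr0// => l /andP[_ /negbTE->].
  by rewrite scale0r.
Qed.

(** An affine function on a triangle is the combination of its vertex values with the barycentric
    coordinates as weights. *)
Lemma hat_bary i j k l x : i != j -> i != k -> j != k ->
  cross (a i) (a j) (a k) != 0 -> [set i; j; k]%SET \in Th ->
  conv_hull a [set i; j; k]%SET x ->
  phi l x = (i == l)%:R * bary (a i) (a j) (a k) x
          + (j == l)%:R * bary (a j) (a k) (a i) x
          + (k == l)%:R * bary (a k) (a i) (a j) x.
Proof.
move=> ij ik jk c0 KTh xK; have [_ aff vert] := hat l.
have [g [c gE]] := aff _ KTh.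
have vE m : m \in [set i; j; k]%SET -> dot g (a m) + c = (m == l)%:R.
  by move=> mK; rewrite -gE ?vert//; exact: conv_hull_vertex.
have mi : i \in [set i; j; k]%SET by rewrite !inE eqxx.
have mj : j \in [set i; j; k]%SET by rewrite !inE eqxx orbT.
have mk : k \in [set i; j; k]%SET by rewrite !inE eqxx orbT.
rewrite gE// {1}(bary_comb x c0) -(vE i mi) -(vE j mj) -(vE k mk).
rewrite !dotDr !dotZr -[X in _ + X = _]mulr1 -(bary_sum x c0); ring.
Qed.

Lemma hat_in i j k x : i != j -> i != k -> j != k ->
  cross (a i) (a j) (a k) != 0 -> [set i; j; k]%SET \in Th ->
  conv_hull a [set i; j; k]%SET x -> phi i x = bary (a i) (a j) (a k) x.
Proof.
move=> ij ik jk c0 KTh xK; rewrite (hat_bary _ ij ik jk c0 KTh xK) eqxx.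
by rewrite !(eq_sym _ i) (negbTE ij) (negbTE ik) mul1r !mul0r !addr0.
Qed.

Lemma hat_out K l x : K \in Th -> l \notin K -> conv_hull a K x -> phi l x = 0.
Proof.
move=> KTh lK; have [K0|[i iK]] := set_0Vmem K.
  by have := mesh_card mesh KTh; rewrite K0 cards0.
have [j [k [KE ij ik jk c0]]] := vertex_element mesh KTh iK.
rewrite {}KE in KTh lK * => xK; rewrite (hat_bary _ ij ik jk c0 KTh xK).
move: lK; rewrite !inE !negb_or ![l == _]eq_sym => /andP[/andP[/negbTE-> /negbTE->] /negbTE->].
by rewrite !mul0r !addr0.
Qed.

Lemma grad_hat_in i j k : i != j -> i != k -> j != k ->
  cross (a i) (a j) (a k) != 0 -> [set i; j; k]%SET \in Th ->
  grad_on a [set i; j; k]%SET (phi i) = bary_grad (a i) (a j) (a k).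
Proof.
move=> ij ik jk c0 KTh.
apply: (@grad_on_affine _ _ _ _ _ _ _ _ _ _ _ _ (bary (a i) (a j) (a k) 0)) => //.
by move=> x xK; rewrite (hat_in ij ik jk c0 KTh xK) baryE0.
Qed.

Lemma grad_hat_out K l : K \in Th -> l \notin K -> grad_on a K (phi l) = 0.
Proof.
move=> KTh lK; have [K0|[i iK]] := set_0Vmem K.
  by have := mesh_card mesh KTh; rewrite K0 cards0.
have [j [k [KE ij ik jk c0]]] := vertex_element mesh KTh iK.
have out x : conv_hull a K x -> phi l x = 0 by exact: hat_out.
rewrite {}KE in KTh lK out *.
apply: (@grad_on_affine _ _ _ _ _ _ _ _ _ _ _ _ 0) => //.
by move=> x /out ->; rewrite dotE !mxE !mul0r !addr0.
Qed.

Lemma int2_hat2 i j k : i != j -> i != k -> j != k ->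
  cross (a i) (a j) (a k) != 0 -> [set i; j; k]%SET \in Th ->
  int2 (conv_hull a [set i; j; k]%SET) (fun x => phi i x * phi i x) =
  area (conv_hull a [set i; j; k]%SET) / 6.
Proof.
move=> ij ik jk c0 KTh; rewrite area_conv_hull// /int2 preimage_conv_hull//.
transitivity (`|cross (a i) (a j) (a k)| / 12); last by field.
rewrite -Rintegral_bary2//; apply: eq_Rintegral => z; rewrite inE => zt.
by rewrite (hat_in ij ik jk c0 KTh)//; apply/conv_hull3.
Qed.

Lemma int2_hat_hat i j k : i != j -> i != k -> j != k ->
  cross (a i) (a j) (a k) != 0 -> [set i; j; k]%SET \in Th ->
  int2 (conv_hull a [set i; j; k]%SET) (fun x => phi j x * phi i x) =
  area (conv_hull a [set i; j; k]%SET) / 12.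
Proof.
move=> ij ik jk c0 KTh; rewrite area_conv_hull// /int2 preimage_conv_hull//.
transitivity (`|cross (a i) (a j) (a k)| / 24); last by field.
rewrite -Rintegral_bary_bary//; apply: eq_Rintegral => z; rewrite inE => zt.
have zK : conv_hull a [set i; j; k]%SET (pt z) by apply/conv_hull3.
rewrite (hat_in ij ik jk c0 KTh zK) mulrC; congr (_ * _).
by rewrite (hat_bary _ ij ik jk c0 KTh zK) eqxx (negbTE ij) (eq_sym k) (negbTE jk)
  !mul0r mul1r add0r addr0.
Qed.

Lemma int2_hat_out K i j : K \in Th -> (i \notin K) || (j \notin K) ->
  int2 (conv_hull a K) (fun x => phi j x * phi i x) = 0.
Proof.
move=> KTh ijK; rewrite /int2 (@eq_Rintegral _ _ _ _ _ (fun _ => 0)).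
  by rewrite /Rintegral integral0.
move=> z; rewrite inE => zK; case/orP: ijK => /(hat_out KTh)/(_ zK) ->.
  by rewrite mulr0.
by rewrite mul0r.
Qed.

End Element.

(** * Averaged diffusion matrix and element stiffness *)

Section ElementMean.
Variables (R : realType) (Nv : nat) (a : 'I_Nv -> 'cV[R]_2).
Variables (Th : {set {set 'I_Nv}}) (Omega : set 'cV[R]_2).
Hypothesis mesh : triangulation a Th Omega.
Variable phi : 'I_Nv -> 'cV[R]_2 -> R.
Hypothesis hat : is_hat_basis a Th Omega phi.
Implicit Types (x y v : 'cV[R]_2) (i j k l : 'I_Nv) (K : {set 'I_Nv}).
Notation leb2 := (@leb2 R).

(** Integrability is given for h alone; it passes to the product because the hat function takes
    values in [0, 1] on the element. The edges are then dropped, as the sign of h is known only in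
    Omega. *)
Lemma int2_mul_hat_le0 K i (h : 'cV[R]_2 -> R) : K \in Th ->
  integrable2 (conv_hull a K) h -> (forall x, Omega x -> h x <= 0) ->
  int2 (conv_hull a K) (fun x => h x * phi i x) <= 0.
Proof.
move=> KTh hi h0; have [iK|iK] := boolP (i \in K); last first.
  rewrite /int2 (@eq_Rintegral _ _ _ _ _ (fun _ => 0)).
    by rewrite /Rintegral integral0.
  by move=> z; rewrite inE => zK; rewrite (hat_out mesh hat KTh iK)// mulr0.
have [j [k [KE ij ik jk c0]]] := vertex_element mesh KTh iK.
rewrite {}KE in KTh hi iK *; rewrite /integrable2 preimage_conv_hull// in hi.
rewrite /int2 preimage_conv_hull//.
set t := triangle _ _ _ in hi *; set b := fun z => bary (a i) (a j) (a k) (pt z).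
have mt := measurable_triangle c0.
have mhb : measurable_fun t (fun z => (h (pt z) * b z)%:E).
  apply/measurable_EFinP; apply: measurable_funM.
    by apply/measurable_EFinP; exact: measurable_int hi.
  by apply: measurable_funTS; exact: measurable_bary.
have bT z : t z -> 0 <= b z <= 1.
  by case=> z1 z2 z3; rewrite z1 /=; have := bary_sum (pt z) c0; rewrite /b; lra.
have ihb : leb2.-integrable t (fun z => (h (pt z) * b z)%:E).
  apply: (le_integrable mt mhb _ hi) => z /bT /andP[b0 b1].
  by rewrite /= lee_fin normrM ler_piMr// ger0_norm.
have -> : \int[leb2]_(z in t) (h (pt z) * phi i (pt z)) =
    \int[leb2]_(z in t) (h (pt z) * b z).
  apply: eq_Rintegral => z; rewrite inE => zt; rewrite (hat_in hat ij ik jk c0 KTh)//.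
  by apply/conv_hull3.
rewrite Rintegral_open_triangle//.
have mo := measurable_open_triangle c0.
apply: (@le_trans _ _ (\int[leb2]_(z in open_triangle (a i) (a j) (a k)) 0)).
  apply: le_Rintegral => //.
  - apply: integrableS ihb => //.
    by rewrite open_triangleE; exact: subDsetl.
  - exact: integrable0.
  - move=> z zo; rewrite mulr_le0_ge0//.
      by apply: h0; exact: (open_triangle_Omega mesh ij ik jk c0 KTh zo).
    by case: zo => /ltW.
by rewrite /Rintegral integral0.
Qed.

Variable D : 'cV[R]_2 -> 'M[R]_2.
Hypothesis spdD : forall x, Omega x -> spd (D x).
Hypothesis intD : forall K p q, K \in Th -> integrable2 (conv_hull a K) (fun x => D x p q).

(** The quadratic form of [meanD] at v is the mean of v^T D v, which is positive on the open
    triangle. *)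
Lemma meanD_spd K : K \in Th -> spd (meanD a D K).
Proof.
move=> KTh; have [K0|[i iK]] := set_0Vmem K.
  by have := mesh_card mesh KTh; rewrite K0 cards0.
have [j [k [KE ij ik jk c0]]] := vertex_element mesh KTh iK.
have ar0 := area_gt0 mesh KTh.
have mt := measurable_triangle c0; have mo := measurable_open_triangle c0.
set t := triangle _ _ _ in mt.
have pK : @pt R @^-1` conv_hull a K = t by rewrite KE preimage_conv_hull.
have iD p q : leb2.-integrable t (EFin \o (fun z => D (pt z) p q)).
  by rewrite -pK; exact: intD.
have spdO z : open_triangle (a i) (a j) (a k) z -> spd (D (pt z)).
  move=> zo; apply: spdD; rewrite KE in KTh.
  exact: (open_triangle_Omega mesh ij ik jk c0 KTh zo).
split.
  apply/matrixP => p q; rewrite !mxE; congr (_ * _).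
  rewrite /int2 pK !(Rintegral_open_triangle c0)//.
  apply: eq_Rintegral => z; rewrite inE => /spdO[sD _].
  by rewrite -[in RHS]sD mxE.
move=> v v0.
have iZ (s : R) p q : leb2.-integrable t (EFin \o (fun z => s * D (pt z) p q)).
  rewrite (_ : _ \o _ = fun z => s%:E * (EFin \o (fun z => D (pt z) p q)) z)%E//.
  exact: integrableZl.
have iDD (f g : R * R -> R) : leb2.-integrable t (EFin \o f) ->
    leb2.-integrable t (EFin \o g) -> leb2.-integrable t (EFin \o (fun z => f z + g z)).
  move=> fi gi; rewrite (_ : _ \o _ = (EFin \o f) \+ (EFin \o g))%E//.
  exact: integrableD.
(* The integrand v^T D v, expanded so that linearity of the integral applies term by term. *)
pose F z := v 0 0 * v 0 0 * D (pt z) 0 0 + (v 0 0 * v 1 0 * D (pt z) 0 1 +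
  (v 0 0 * v 1 0 * D (pt z) 1 0 + v 1 0 * v 1 0 * D (pt z) 1 1)).
have -> : dot v (meanD a D K *m v) = (area (conv_hull a K))^-1 * \int[leb2]_(z in t) F z.
  rewrite /F RintegralD//; last by do 2 apply: (iDD _ _) => //.
  rewrite RintegralD//; last by apply: (iDD _ _).
  rewrite RintegralD// !RintegralZl// dotE !mulmx2 !mxE /int2 pK; ring.
rewrite mulr_gt0 ?invr_gt0//; apply: Rintegral_triangle_gt0 => //.
  by do 3 apply: (iDD _ _) => //.
move=> z /spdO[_ /(_ _ v0)]; rewrite /F dotE !mulmx2 => h.
by rewrite [ltRHS](_ : _ = v 0 0 * (D (pt z) 0 0 * v 0 0 + D (pt z) 0 1 * v 1 0) +
 v 1 0 * (D (pt z) 1 0 * v 0 0 + D (pt z) 1 1 * v 1 0)); last by ring.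
Qed.

(** Since the area is |cross| / 2, both sides equal - codot / (2 |cross|), by [codot_cross] on the
    left and [sqrt_det_cot] on the right. *)
Lemma stiffness_offdiag i j k : i != j -> i != k -> j != k ->
  cross (a i) (a j) (a k) != 0 -> [set i; j; k]%SET \in Th ->
  let K := [set i; j; k]%SET in
  area (conv_hull a K) *
    dot (grad_on a K (phi i)) (meanD a D K *m grad_on a K (phi j)) =
  - (Num.sqrt (\det (meanD a D K)) * cot (alpha a D i j k)) / 2 /\
  0 < alpha a D i j k < pi.
Proof.
move=> ij ik jk c0 KTh K.
have spdK := meanD_spd KTh.
have [cotE alphapi] := sqrt_det_cot spdK c0; split => //.
have ji : j != i by rewrite eq_sym.
have [ki kj] : k != i /\ k != j by rewrite !(eq_sym k).
have gj : grad_on a K (phi j) = bary_grad (a j) (a k) (a i).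
  rewrite /K -set3_rot; apply: (grad_hat_in hat) => //.
    by rewrite cross_rot.
  by rewrite set3_rot.
rewrite (grad_hat_in hat ij ik jk c0 KTh) gj codot_cross//; last by case: spdK.
rewrite /alpha cotE area_conv_hull// -[cross _ _ _ ^+ 2]real_normK ?num_real//.
by field; rewrite normr_eq0.
Qed.

Lemma stiffness_diag i K : K \in Th -> i \in K ->
  area (conv_hull a K) *
    dot (grad_on a K (phi i)) (meanD a D K *m grad_on a K (phi i)) <=
  area (conv_hull a K) * lambda_max (meanD a D K) * height a K i ^- 2.
Proof.
move=> KTh iK; have [j [k [KE ij ik jk c0]]] := vertex_element mesh KTh iK.
have [symK _] := meanD_spd KTh.
rewrite -mulrA ler_wpM2l//; first by rewrite ltW// (area_gt0 mesh).
rewrite {}KE in KTh symK iK *; rewrite height_sqr// (grad_hat_in hat)//.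
exact: lambda_max_ge.
Qed.

End ElementMean.

(** * Mass and stiffness matrices *)

Section Assembly.
Variables (R : realType) (Nv : nat) (a : 'I_Nv -> 'cV[R]_2).
Variables (Th : {set {set 'I_Nv}}) (Omega : set 'cV[R]_2).
Hypothesis mesh : triangulation a Th Omega.
Variable phi : 'I_Nv -> 'cV[R]_2 -> R.
Hypothesis hat : is_hat_basis a Th Omega phi.
Variable D : 'cV[R]_2 -> 'M[R]_2.
Hypothesis spdD : forall x, Omega x -> spd (D x).
Hypothesis intD : forall K p q, K \in Th -> integrable2 (conv_hull a K) (fun x => D x p q).
Implicit Types (x y v : 'cV[R]_2) (i j k l : 'I_Nv) (K : {set 'I_Nv}).

Notation leb2 := (@leb2 R).
Notation mR2 := (measurableTypeR R * measurableTypeR R)%type.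

Definition mass i j : R :=
  \sum_(K in Th) int2 (conv_hull a K) (fun x => phi j x * phi i x).

Definition stiff i j : R :=
  \sum_(K in Th) area (conv_hull a K) *
    dot (grad_on a K (phi i)) (meanD a D K *m grad_on a K (phi j)).

Lemma mass_element K i j : K \in Th ->
  int2 (conv_hull a K) (fun x => phi j x * phi i x) =
  if (i \in K) && (j \in K) then
    area (conv_hull a K) / (if i == j then 6 else 12)
  else 0.
Proof.
move=> KTh; have [/andP[iK jK]|] := ifPn; last first.
  by rewrite negb_and => ijK; exact: (int2_hat_out mesh hat KTh ijK).
have [ij|ij] := eqVneq i j.
  have [m [n [KE lm ln mn c0]]] := vertex_element mesh KTh iK.
  by rewrite {}KE -ij in KTh *; exact: (int2_hat2 hat).
have [k [KE ik jk c0]] := edge_element mesh KTh iK jK ij.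
by rewrite {}KE in KTh *; exact: (int2_hat_hat hat).
Qed.

Lemma mass_element_ge0 K i j : K \in Th ->
  0 <= int2 (conv_hull a K) (fun x => phi j x * phi i x).
Proof.
move=> KTh; rewrite mass_element//; case: ifP => // _.
by rewrite divr_ge0 ?ltW ?(area_gt0 mesh)//; case: ifP.
Qed.

Lemma mass_ge0 i j : 0 <= mass i j.
Proof. by apply: sumr_ge0 => K KTh; exact: mass_element_ge0. Qed.

Lemma mass_diag i : mass i i = (\sum_(K in Defs.patch Th i) area (conv_hull a K)) / 6.
Proof.
rewrite mulr_suml /mass big_mkcond [RHS]big_mkcond /=; apply: eq_bigr => K _.
rewrite inE; case: ifPn => // KTh /=.
by rewrite mass_element// andbb eqxx.
Qed.

Lemma mass_diag_gt0 i : 0 < mass i i.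
Proof.
have [K KTh iK] := mesh_vertices mesh i.
have KP : K \in Defs.patch Th i by rewrite inE KTh.
rewrite mass_diag divr_gt0// (bigD1 K)//= ltr_wpDr//; last exact: (area_gt0 mesh).
by apply: sumr_ge0 => L /andP[]; rewrite inE => /andP[LTh _] _; rewrite ltW// (area_gt0 mesh).
Qed.

Lemma leb2_conv_hull K : K \in Th -> measurable (@pt R @^-1` conv_hull a K : set mR2) /\
  leb2 (@pt R @^-1` conv_hull a K) = (area (conv_hull a K))%:E.
Proof.
move=> KTh; have [K0|[m mK]] := set_0Vmem K.
  by have := mesh_card mesh KTh; rewrite K0 cards0.
have [n [l [-> mn ml nl c0]]] := vertex_element mesh KTh mK.
rewrite area_conv_hull// preimage_conv_hull//; split; first exact: measurable_triangle.
exact: leb2_triangle.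
Qed.

(** The area of the patch is the measure of a union, and the numerator of the upper bound on the
    time step only has to be bounded above; subadditivity thus suffices, without showing that
    overlaps are null. *)
Lemma patch_area_le i : patch_area a Th i <= 6 * mass i i.
Proof.
rewrite mass_diag mulrCA divff// mulr1 /patch_area [leLHS]/area.
rewrite (_ : \bigcup_(K in _) _ =
    \bigcup_(K in [set` enum (Defs.patch Th i)]) conv_hull a K); last first.
  by apply/seteqP; split => x [K /=]; rewrite ?mem_enum => KP xK;
    exists K; rewrite //= ?mem_enum.
rewrite -[leRHS]big_enum /=.
have : {subset enum (Defs.patch Th i) <= Th}.
  by move=> K; rewrite mem_enum inE => /andP[].
move: (enum _) => s sTh.
suff [ms ls] : measurable (@pt R @^-1` (\bigcup_(K in [set` s]) conv_hull a K) : set mR2) /\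
    (leb2 (@pt R @^-1` (\bigcup_(K in [set` s]) conv_hull a K)) <=
     (\sum_(K <- s) area (conv_hull a K))%:E)%E.
  by rewrite -lee_fin fineK// ge0_fin_numE// (le_lt_trans ls)// ltry.
elim: s sTh => [_|K s IH sTh].
  rewrite !bigcup_seq !big_nil preimage_set0; split; first exact: measurable0.
  by have -> : leb2 set0 = 0%E by exact: measure0.
have [ms ls] : _ /\ _ := IH (fun L Ls => sTh L (mem_behead (s := K :: s) Ls)).
have [mK lK] := leb2_conv_hull (sTh K (mem_head _ _)).
rewrite bigcup_seq !big_cons preimage_setU -bigcup_seq EFinD; split.
  exact: measurableU.
by rewrite (le_trans (measureU2 leb2 mK ms))// leeD// -lK.
Qed.

(** On each element only its three hat functions have a nonzero gradient, and these gradients sum to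
    zero. So the rows of B and C have the same sum, that of the mass row. *)
Lemma stiff_sum i : \sum_j stiff i j = 0.
Proof.
rewrite /stiff exchange_big /=; apply: big1 => K KTh.
rewrite -mulr_sumr (_ : \sum_j _ = 0) ?mulr0//.
have dot_sum (u : 'cV[R]_2) (F : 'I_Nv -> 'cV[R]_2) :
    \sum_j dot u (F j) = dot u (\sum_j F j).
  rewrite dotE !summxE !mulr_sumr -big_split /=; apply: eq_bigr => j _.
  by rewrite dotE.
rewrite dot_sum -mulmx_sumr (_ : \sum_j _ = 0) ?mulmx0 ?dotE ?mxE ?mulr0 ?addr0//.
have [K0|[m mK]] := set_0Vmem K.
  by have := mesh_card mesh KTh; rewrite K0 cards0.
have [n [l [KE mn ml nl c0]]] := vertex_element mesh KTh mK.
rewrite (bigID (mem K))/= [X in _ + X]big1 ?addr0; last first.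
  by move=> j jK; exact: (grad_hat_out mesh hat).
rewrite {1}KE sum_set3//.
have c1 : cross (a n) (a l) (a m) != 0 by rewrite cross_rot.
have c2 : cross (a l) (a m) (a n) != 0 by rewrite cross_rot.
have nm : n != m by rewrite eq_sym.
have [lm ln] : l != m /\ l != n by rewrite !(eq_sym l).
have gm : grad_on a K (phi m) = bary_grad (a m) (a n) (a l).
  by rewrite {}KE in KTh *; exact: (grad_hat_in hat).
have gn : grad_on a K (phi n) = bary_grad (a n) (a l) (a m).
  by rewrite {}KE -set3_rot in KTh *; exact: (grad_hat_in hat).
have gl : grad_on a K (phi l) = bary_grad (a l) (a m) (a n).
  by rewrite {}KE -set3_rot -set3_rot in KTh *; exact: (grad_hat_in hat).
by rewrite gm gn gl; exact: bary_grad0.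
Qed.

Lemma stiff_diag_le i : stiff i i <=
  \sum_(K in Defs.patch Th i) (area (conv_hull a K) * lambda_max (meanD a D K) * height a K i ^- 2).
Proof.
rewrite /stiff big_mkcond [leRHS]big_mkcond /=; apply: ler_sum => K _.
rewrite inE; case: ifPn => //= KTh.
case: ifPn => iK; first exact: (stiffness_diag mesh hat spdD intD).
by rewrite (grad_hat_out mesh hat)// dotE !mxE !mul0r addr0 mulr0.
Qed.

(** Either no element contains both vertices, or exactly two do, by [edge_elements]. The positivity
    facts are those required by the mesh condition and by the bound on the time step. *)
Lemma offdiag i j : Omega (a i) -> i != j ->
  (mass i j = 0 /\ stiff i j = 0) \/
  exists k k', interior_edge a Th Omega i j k k' /\
    let K := [set i; j; k]%SET in let K' := [set i; j; k']%SET in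
    [/\ mass i j = (area (conv_hull a K) + area (conv_hull a K')) / 12,
        stiff i j = - (Num.sqrt (\det (meanD a D K)) * cot (alpha a D i j k)
           + Num.sqrt (\det (meanD a D K')) * cot (alpha a D i j k')) / 2,
        0 < area (conv_hull a K) + area (conv_hull a K') &
        [/\ 0 < \det (meanD a D K), 0 < \det (meanD a D K'),
            0 < alpha a D i j k < pi & 0 < alpha a D i j k' < pi]].
Proof.
move=> Oi ij.
have massE : mass i j = \sum_(K in [set K in Th | (i \in K) && (j \in K)]%SET)
    area (conv_hull a K) / 12.
  rewrite /mass big_mkcond [RHS]big_mkcond /=; apply: eq_bigr => K _.
  by rewrite inE; case: ifPn => //= KTh; rewrite mass_element// (negbTE ij).
have stiffE : stiff i j = \sum_(K in [set K in Th | (i \in K) && (j \in K)]%SET)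
    area (conv_hull a K) *
    dot (grad_on a K (phi i)) (meanD a D K *m grad_on a K (phi j)).
  rewrite /stiff big_mkcond [RHS]big_mkcond /=; apply: eq_bigr => K _.
  rewrite inE; case: ifPn => //= KTh; case: ifPn => //.
  rewrite negb_and => /orP[] h; rewrite (grad_hat_out mesh hat KTh h).
    by rewrite dotE !mxE !mul0r addr0 mulr0.
  by rewrite mulmx0 dotE !mxE !mulr0 addr0 mulr0.
have [E0|[K]] := set_0Vmem [set K in Th | (i \in K) && (j \in K)]%SET.
  by left; rewrite massE stiffE E0 !big_set0.
rewrite inE => /and3P[KTh iK jK]; right.
have [k [KE ik jk c0]] := edge_element mesh KTh iK jK ij.
rewrite {}KE in KTh iK jK.
have [k' [edge ik' jk' c0' [EE KK']]] := edge_elements mesh Oi KTh ij ik jk c0.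
have /and4P[kk' _ K'Th _] := edge.
exists k, k'; split => // L L'.
have sum2 (F : {set 'I_Nv} -> R) : \sum_(M in [set L; L']%SET) F M = F L + F L'.
  exact: sum_set2.
have [s1 p1] := stiffness_offdiag mesh hat spdD intD ij ik jk c0 KTh.
have [s2 p2] := stiffness_offdiag mesh hat spdD intD ij ik' jk' c0' K'Th.
have [_ _ d1] := spd_det_gt0 (meanD_spd mesh spdD intD KTh).
have [_ _ d2] := spd_det_gt0 (meanD_spd mesh spdD intD K'Th).
split => //.
- by rewrite massE EE sum2// -mulrDl.
- rewrite stiffE EE sum2// s1 s2 /L /L'; ring.
- by rewrite addr_gt0 ?(area_gt0 mesh).
Qed.

End Assembly.

(** * The maximum principle *)

Lemma max_edge_ratio_ge (R : realType) (Nv : nat) (a : 'I_Nv -> 'cV[R]_2)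
    (Th : {set {set 'I_Nv}}) (Omega : set 'cV[R]_2) (D : 'cV[R]_2 -> 'M[R]_2)
    (i j k k' : 'I_Nv) : interior_edge a Th Omega i j k k' ->
  ((area (conv_hull a [set i; j; k]%SET) + area (conv_hull a [set i; j; k']%SET))%:E /
    (Num.sqrt (\det (meanD a D [set i; j; k]%SET)) * cot (alpha a D i j k)
    + Num.sqrt (\det (meanD a D [set i; j; k']%SET)) * cot (alpha a D i j k'))%:E <=
  max_edge_ratio a Th Omega D)%E.
Proof.
move=> e; rewrite /max_edge_ratio.
apply: le_trans; last exact: (@le_bigmax_cond _ _ _ _ i xpredT _ isT).
apply: le_trans; last exact: (@le_bigmax_cond _ _ _ _ j xpredT _ isT).
apply: le_trans; last exact: (@le_bigmax_cond _ _ _ _ k xpredT _ isT).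
exact: (le_bigmax_cond _ _ e).
Qed.

(** Here x = |K| + |K'| and y = S. The factor 6 is the ratio of 12, from the mass entry, to 2, from
    the stiffness entry. *)
Lemma edge_entry_le0 (R : realType) (theta dt x y : R) : 0 <= y ->
  x <= 6 * theta * dt * y ->
  x / 12 + theta * dt * (- y / 2) <= 0 /\ - y / 2 <= 0.
Proof. by move=> y0 xy; split; lra. Qed.

(** Here c = 1 - theta, P is the patch area, s and m are the diagonal stiffness and mass entries,
    and S bounds s; the factor 6 comes from the diagonal mass entry. *)
Lemma vertex_entry_ge0 (R : realType) (c dt s S P m : R) :
  6 * c * dt * S <= P -> P <= 6 * m -> c * dt * s <= c * dt * S -> c * dt * s <= m.
Proof. lra. Qed.

Lemma edge_time_step (R : realType) (c x y dt : R) (m : \bar R) : 0 < c -> 0 < x -> 0 <= y ->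
  (x%:E / y%:E <= m)%E -> ((c%:E)^-1 * m <= dt%:E)%E -> x <= c * dt * y.
Proof.
move=> c0 x0 y0 xym mdt.
have : ((c%:E)^-1 * (x%:E / y%:E) <= dt%:E)%E.
  by apply: le_trans mdt; rewrite lee_wpmul2l// inve_ge0 lee_fin ltW.
(* For y = 0 the quotient is +oo, and so is its product with the inverse of c, which contradicts the
   bound by dt. *)
rewrite !inver (gt_eqF c0); have [->|y_neq0] := eqVneq y 0.
  by rewrite mulry gtr0_sg// mul1e mulry gtr0_sg ?invr_gt0// mul1e leye_eq.
have y_gt0 : 0 < y by rewrite lt_neqAle eq_sym y_neq0.
by rewrite -!EFinM lee_fin ler_pdivrMl// ler_pdivrMr.
Qed.

Lemma vertex_time_step (R : realType) (c x y dt : R) (m : \bar R) : 0 < c -> 0 < y ->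
  (m <= (x / y)%:E)%E -> (dt%:E <= (c%:E)^-1 * m)%E -> c * dt * y <= x.
Proof.
move=> c0 y0 mxy mdt.
have : (dt%:E <= (c%:E)^-1 * (x / y)%:E)%E.
  by apply: (le_trans mdt); rewrite lee_wpmul2l// inve_ge0 lee_fin ltW.
rewrite !inver (gt_eqF c0) -!EFinM lee_fin ler_pdivlMl//.
by rewrite ler_pdivlMr.
Qed.

(* At an interior index m maximizing [v], the signs of the row of [B] give
   (sum_j B m j) * v m <= sum_j B m j * v j <= (sum_j C m j) * M. *)
Lemma discrete_max_step (R : realType) (Ni Nb : nat)
    (B C : 'I_Ni -> 'I_(Ni + Nb) -> R) (u v : 'I_(Ni + Nb) -> R) (F : 'I_Ni -> R) (M : R) :
  (forall i j, lshift Nb i != j -> B i j <= 0) ->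
  (forall i j, 0 <= C i j) ->
  (forall i, \sum_j B i j = \sum_j C i j) ->
  (forall i, 0 < \sum_j C i j) ->
  (forall i, F i <= 0) ->
  (forall i, \sum_j B i j * v j = \sum_j C i j * u j + F i) ->
  (forall j, u j <= M) -> (forall j : 'I_Nb, v (rshift Ni j) <= M) ->
  forall j, v j <= M.
Proof.
move=> B_le0 C_ge0 BC s_gt0 F_le0 step uM vM j.
case: (split_ordP j) => [i ->|k ->]; last exact: vM.
pose m := [arg max_(i' > i) v (lshift Nb i')]%O.
have vm i' : v (lshift Nb i') <= v (lshift Nb m).
  by rewrite /m; case: arg_maxP => // m' _; apply.
apply: (le_trans (vm i)); rewrite leNgt; apply/negP => Mlt.
(* Under the contrary assumption v m > M, the index m beats the boundary values too, so it is a
   maximizer over all vertices. *)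
have vmax l : v l <= v (lshift Nb m).
  by case: (split_ordP l) => [i' ->//|k ->]; rewrite (le_trans (vM k))// ltW.
have : \sum_j C m j * u j + F m <= (\sum_j C m j) * M.
  rewrite -[leRHS]addr0 lerD// mulr_suml; apply: ler_sum => l _.
  by rewrite ler_wpM2l.
rewrite -step; apply/negP; rewrite -ltNge.
apply: (@lt_le_trans _ _ ((\sum_j C m j) * v (lshift Nb m))); first by rewrite ltr_pM2l.
rewrite -BC mulr_suml; apply: ler_sum => l _.
have [<-//|ml] := eqVneq (lshift Nb m) l.
by rewrite ler_wnM2l// B_le0.
Qed.

(** * Finite element functions and their nodal values *)

Section FiniteElementFunction.
Variables (R : realType) (Ni Nb : nat) (a : 'I_(Ni + Nb) -> 'cV[R]_2).
Variables (Th : {set {set 'I_(Ni + Nb)}}) (Omega : set 'cV[R]_2).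
Hypothesis mesh : triangulation a Th Omega.
Variable phi : 'I_(Ni + Nb) -> 'cV[R]_2 -> R.
Hypothesis hat : is_hat_basis a Th Omega phi.
Implicit Types (v : 'cV[R]_(Ni + Nb)) (x : 'cV[R]_2).

Lemma fe_fun_vertex v j : fe_fun phi v (a j) = v j 0.
Proof.
rewrite /fe_fun (bigD1 j)//= big1 => [|l lj].
  by have [_ _ ->] := hat j; rewrite eqxx mulr1 addr0.
by have [_ _ ->] := hat l; rewrite eq_sym (negbTE lj) mulr0.
Qed.

Lemma vertex_closure j : closure Omega (a j).
Proof.
rewrite (mesh_cover mesh); have [K KTh jK] := mesh_vertices mesh j.
by exists K => //; exact: conv_hull_vertex.
Qed.

(** On each element the hat functions are nonnegative with sum 1, so the value at x is a convex
    combination of nodal values. *)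
Lemma fe_fun_le v (m : R) x : (forall j, v j 0 <= m) -> closure Omega x ->
  fe_fun phi v x <= m.
Proof.
move=> vm; rewrite (mesh_cover mesh) => -[K /= KTh xK].
have [K0|[i iK]] := set_0Vmem K.
  by have := mesh_card mesh KTh; rewrite K0 cards0.
have [j [k [KE ij ik jk c0]]] := vertex_element mesh KTh iK.
rewrite {}KE in KTh xK iK.
have phiE l := hat_bary hat l ij ik jk c0 KTh xK.
have [b1 b2 b3] := (conv_hull3 x ij ik jk c0).1 xK.
have sum1 n (b : R) : \sum_l (n == l)%:R * b = b :> R.
  rewrite (bigD1 n)//= eqxx mul1r big1 ?addr0// => l.
  by rewrite eq_sym => /negbTE->; rewrite mul0r.
have -> : m = \sum_l m * phi l x.
  rewrite -mulr_sumr; under eq_bigr do rewrite phiE.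
  by rewrite !big_split/= !sum1 bary_sum// mulr1.
apply: ler_sum => l _; rewrite ler_wpM2r// phiE.
by rewrite !addr_ge0// mulr_ge0// ler0n.
Qed.

End FiniteElementFunction.

Section SchemeRows.
Variables (R : realType) (Ni Nb : nat) (a : 'I_(Ni + Nb) -> 'cV[R]_2).
Variables (Th : {set {set 'I_(Ni + Nb)}}).
Variable phi : 'I_(Ni + Nb) -> 'cV[R]_2 -> R.
Variables (D : 'cV[R]_2 -> 'M[R]_2) (theta dt : R).

Lemma Bmx_row i j : Bmx a Th phi D theta dt (lshift Nb i) j =
  mass a Th phi (lshift Nb i) j + theta * dt * stiff a Th phi D (lshift Nb i) j.
Proof. by rewrite /Bmx addmxE scalemxE /block_mx !col_mxEu !hsubmxK !mxE. Qed.

Lemma Cmx_row i j : Cmx a Th phi D theta dt (lshift Nb i) j =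
  mass a Th phi (lshift Nb i) j - (1 - theta) * dt * stiff a Th phi D (lshift Nb i) j.
Proof.
by rewrite /Cmx -scaleNr addmxE scalemxE /block_mx !col_mxEu !hsubmxK !mxE mulNr.
Qed.

End SchemeRows.

Unset Implicit Arguments.

Theorem theorem3p3 (R : realType)
  (Omega : set 'cV[R]_2) (T : R) (D : 'cV[R]_2 -> 'M[R]_2)
  (f g : 'cV[R]_2 -> R -> R) (u0 : 'cV[R]_2 -> R)
  (Ni Nb : nat) (a : 'I_(Ni + Nb) -> 'cV[R]_2)
  (Th : {set {set 'I_(Ni + Nb)}}) (phi : 'I_(Ni + Nb) -> 'cV[R]_2 -> R)
  (theta dt : R) (N : nat)
  (hT : 0 < T)
  (hmesh : triangulation a Th Omega)
  (hint : forall i : 'I_Ni, Omega (a (lshift Nb i)))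
  (hbnd : forall j : 'I_Nb, boundary Omega (a (rshift Ni j)))
  (hphi : is_hat_basis a Th Omega phi)
  (hD : forall x, Omega x -> spd (D x))
  (hDint : forall K p q, K \in Th ->
     integrable2 (conv_hull a K) (fun x => D x p q))
  (hfint : forall K (t : R), K \in Th -> 0 < t <= T ->
     integrable2 (conv_hull a K) (fun x => f x t))
  (htheta : 0 < theta <= 1) (hdt : 0 < dt)
  (hN : (1 <= N)%N) (hNT : N%:R * dt <= T)
  (hdelaunay : delaunay_condition a Th Omega D)
  (hlower : ((6 * theta)%:E^-1 * max_edge_ratio a Th Omega D <= dt%:E)%E)
  (hupper :
     (dt%:E <= (6 * (1 - theta))%:E^-1 * min_vertex_ratio a Th D)%E)
  (hf : forall x (t : R), Omega x -> 0 < t <= T -> f x t <= 0)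
  (u : nat -> 'cV[R]_(Ni + Nb))
  (hu0 : u 0%N = \col_i u0 (a i))
  (hu : forall n, (n < N)%N ->
     Bmx a Th phi D theta dt *m u n.+1 =
     Cmx a Th phi D theta dt *m u n + dt *: rhs a Th phi f g theta dt n) :
  (\big[maxe/-oo]_(0 <= n < N.+1) max_on (closure Omega) (fe_fun phi (u n))
   <= maxe 0 (maxe
        (\big[maxe/-oo]_(1 <= n < N.+1)
           max_on (boundary Omega) (fe_fun phi (u n)))
        (max_on (closure Omega) (fe_fun phi (u 0%N)))))%E.
Proof.
have [theta0 theta1] := andP htheta.
pose I := @lshift Ni Nb.
pose m := mass a Th phi; pose s := stiff a Th phi D.
have edge_bounds i j : I i != j ->
    m (I i) j + theta * dt * s (I i) j <= 0 /\ s (I i) j <= 0.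
  move=> ij; have [[mE sE]|[k [k' [edge [mE sE x0 [d0 d0' al al']]]]]] :=
    offdiag hmesh hphi hD hDint (hint i) ij.
    by rewrite /m /s mE sE mulr0 addr0.
  have y0 := delaunay_edge_ge0 d0 d0' al al' (hdelaunay _ _ _ _ edge).
  have c0 : 0 < 6 * theta by rewrite mulr_gt0.
  have := edge_time_step c0 x0 y0 (max_edge_ratio_ge D edge) hlower.
  by rewrite /m /s mE sE; exact: edge_entry_le0 y0.
pose B i j := m (I i) j + theta * dt * s (I i) j.
pose C i j := m (I i) j - (1 - theta) * dt * s (I i) j.
have B_le0 i j : I i != j -> B i j <= 0 by move=> /edge_bounds[].
have C_ge0 i j : 0 <= C i j.
  have td0 : 0 <= (1 - theta) * dt by rewrite mulr_ge0 ?subr_ge0// ltW.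
  have [<-|ij] := eqVneq (I i) j; last first.
    have [_ s0] := edge_bounds _ _ ij.
    by rewrite subr_ge0 (le_trans (mulr_ge0_le0 td0 s0))// (mass_ge0 hmesh hphi).
  rewrite subr_ge0.
  have m0 := mass_diag_gt0 hmesh hphi (I i).
  (* For theta = 1 the upper bound imposes nothing, but the stiffness term also disappears from
     C. *)
  have [th1|th1] := eqVneq theta 1.
    by rewrite th1 subrr !mul0r; exact: ltW.
  have th_lt1 : 0 < 1 - theta by rewrite subr_gt0 lt_neqAle th1 theta1.
  have sle := stiff_diag_le hmesh hphi hD hDint (I i).
  have := patch_area_le hmesh hphi (I i).
  set S := \sum_(K in _) _ in sle; move=> Ple.
  (* [vertex_time_step] needs S > 0; for S <= 0 the diagonal stiffness entry is nonpositive and the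
     bound is immediate. *)
  have [S0|S0] := leP S 0.
    by rewrite (le_trans (mulr_ge0_le0 td0 (le_trans sle S0)))// ltW.
  have c0 : 0 < 6 * (1 - theta) by rewrite mulr_gt0.
  have Pge := vertex_time_step c0 S0 (bigmin_le_cond _ _ (isT : xpredT i)) hupper.
  by apply: (vertex_entry_ge0 Pge Ple); rewrite ler_wpM2l.
have BC i : \sum_j B i j = \sum_j C i j.
  by rewrite /B /C sumrB big_split/= -!mulr_sumr (stiff_sum hmesh hphi) !mulr0 addr0 subr0.
have s_gt0 i : 0 < \sum_j C i j.
  rewrite /C sumrB -mulr_sumr (stiff_sum hmesh hphi) mulr0 subr0 (bigD1 (I i))//=.
  rewrite ltr_wpDr ?(mass_diag_gt0 hmesh hphi)// sumr_ge0// => j _.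
  exact: (mass_ge0 hmesh hphi).
have load_le0 n i : (n < N)%N -> dt * load a Th phi f i (tm dt n + theta * dt) <= 0.
  move=> nN; apply: mulr_ge0_le0; [exact: ltW|apply: sumr_le0 => K KTh].
  (* The sign of f is assumed on (0, T] only: theta > 0 excludes time zero at n = 0, and theta <= 1
     with n < N keeps the time below N dt. *)
  have tT : 0 < tm dt n + theta * dt <= T.
    have tm0 : 0 <= tm dt n by rewrite mulr_ge0 ?ler0n// ltW.
    rewrite ltr_wpDl ?mulr_gt0//=; apply: le_trans hNT.
    rewrite -mulrDl ler_pM2r//; apply: (@le_trans _ _ n.+1%:R).
      by rewrite -natr1 lerD2l.
    by rewrite ler_nat.
  apply: (int2_mul_hat_le0 hmesh hphi _ KTh (hfint K _ KTh tT)) => x Ox.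
  exact: hf.
have step n i : (n < N)%N -> \sum_j B i j * u n.+1 j 0 =
    \sum_j C i j * u n j 0 + dt * load a Th phi f i (tm dt n + theta * dt).
  move=> nN; have := congr1 (fun v : 'cV[R]_(Ni + Nb) => v (I i) 0) (hu n nN).
  rewrite addmxE scalemxE /rhs col_mxEu !mxE.
  under eq_bigr do rewrite Bmx_row.
  by under [X in _ = X + _ -> _]eq_bigr do rewrite Cmx_row.
set M := (maxe 0 _)%E.
have M0 : (0 <= M)%E by rewrite /M le_max lexx.
(* The 0 in the maximum excludes -oo and +oo makes the claim trivial, which leaves a real bound r
   for the induction on nodal values. *)
case ME : M M0 => [r| |//] M0; last by rewrite leey.
have vertex_le (v : 'cV[R]_(Ni + Nb)) : (forall j, v j 0 <= r) ->
    (max_on (closure Omega) (fe_fun phi v) <= r%:E)%E.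
  move=> vr; apply: ge_ereal_sup => _ [x xO <-]; rewrite lee_fin.
  exact: (fe_fun_le hmesh hphi).
suff ur n : (n <= N)%N -> forall j, u n j 0 <= r.
  rewrite big_nat; elim/big_ind: _ => [|p q pr qr|n /andP[_ nN]].
  - by rewrite leNye.
  - by rewrite ge_max pr.
  - exact: vertex_le (ur n nN).
elim: n => [_ j|n IH nN].
  rewrite -lee_fin -ME /M !le_max -(fe_fun_vertex hphi).
  apply/orP; right; apply/orP; right; apply: ereal_sup_ubound.
  by exists (a j) => //; exact: (vertex_closure hmesh).
apply: (discrete_max_step (u := fun j => u n j 0) (v := fun j => u n.+1 j 0)
  B_le0 C_ge0 BC s_gt0 (load_le0 n ^~ nN)) => [i| |j].
- exact: step.
- exact: IH (ltnW nN).
(* Boundary values are needed only at levels n.+1 >= 1, the range of the boundary maximum in the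
   statement. *)
rewrite -lee_fin -ME /M !le_max -(fe_fun_vertex hphi).
apply/orP; right; apply/orP; left.
apply: (@le_trans _ _ (max_on (boundary Omega) (fe_fun phi (u n.+1)))).
  by apply: ereal_sup_ubound; exists (a (rshift Ni j)).
apply: (le_bigmax_seq _ n.+1 xpredT (fun l => max_on (boundary Omega) (fe_fun phi (u l)))) => //.
by rewrite mem_index_iota.
Qed.
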